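(* Under the standing assumptions below with $r=1$, let $\theta>0$ denote the sole nonzero eigenvalue of $P_n$. Let $j\in\{1,\dots,\ell\}$ be such that $1/\theta\notin\big(G_{\mu_X}(a_{j-1}^-),G_{\mu_X}(b_j^+)\big)$, $G'_{\mu_X}(b_j^+)=-\infty$, and, if $j\ge 2$, $G'_{\mu_X}(a_{j-1}^-)=-\infty$. For each $n$ let $\widetilde u$ be a unit-norm eigenvector of $\widetilde X_n$ associated with $\lambda_{\lceil nc_{j-1}\rceil+1}(\widetilde X_n)$. Then $\langle\widetilde u,\ker(\theta I_n-P_n)\rangle\xrightarrow{a.s.}0$ as $n\to\infty$.
   Context: Standing assumptions (Hermitian setting). For each $n$, $X_n$ is an $n\times n$ real symmetric (resp. complex Hermitian) random matrix whose distribution is invariant under conjugation by orthogonal (resp. unitary) matrices, with ordered eigenvalues $\lambda_1(X_n)\ge\cdots\ge\lambda_n(X_n)$. The empirical eigenvalue distribution $\mu_{X_n}=\frac1n\sum_{i=1}^n\delta_{\lambda_i(X_n)}$ converges almost surely weakly to a non-random compactly supported probability measure $\mu_X=\sum_{j=1}^{\ell}p_j\mu_j$, where $p_j>0$, $\sum_j p_j=1$, each $\mu_j$ is a non-random probability measure supported on $[a_j,b_j]$ with $d\mu_j(z)>0$ for $z\in(a_j,b_j)$, and $a_\ell<b_\ell<a_{\ell-1}<b_{\ell-1}<\cdots<a_1<b_1$. Set $c_0=0$, $c_k=\sum_{i=1}^k p_i$. It is assumed that for $j=1,\dots,\ell$, $\lambda_{\lceil nc_{j-1}\rceil+1}(X_n)\to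 b_j$ and $\lambda_{\lceil nc_j\rceil}(X_n)\to a_j$ almost surely. $P_n$ is a deterministic $n\times n$ symmetric (resp. Hermitian) matrix of rank $r$ with fixed positive nonzero eigenvalues independent of $n$; $X_n$ and $P_n$ are independent; $\widetilde X_n=X_n+P_n$ with ordered eigenvalues $\lambda_1(\widetilde X_n)\ge\cdots\ge\lambda_n(\widetilde X_n)$. $G_{\mu_X}(z)=\int\frac{1}{z-t}d\mu_X(t)$ for $z\notin\mathrm{supp}\,\mu_X$; $f(c^+)=\lim_{z\downarrow c}f(z)$, $f(c^-)=\lim_{z\uparrow c}f(z)$; $a_0:=+\infty$ (so $G_{\mu_X}(a_0^-)=0$). For a subspace $F$ and vector $x$, $\langle x,F\rangle$ denotes the norm of the orthogonal projection of $x$ onto $F$. *)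

(* Defs.v *)
From HB Require Import structures.
From mathcomp Require Import all_boot all_order all_algebra.
From mathcomp Require Import all_classical all_reals all_analysis.
From mathcomp Require Import complex.
Set Implicit Arguments.
Unset Strict Implicit.
Unset Printing Implicit Defensive.
Import Order.TTheory GRing.Theory Num.Theory.
Import numFieldNormedType.Exports.
Local Open Scope ring_scope.
Local Open Scope classical_set_scope.

(* Both settings of the paper are handled inside the complex field R[i]:
   real_case = true  : real symmetric matrices, orthogonal invariance, R^n;
   real_case = false : complex Hermitian matrices, unitary invariance, C^n. *)

Definition adjmx {R : realType} m n (M : 'M[R[i]]_(m, n)) : 'M[R[i]]_(n, m) :=
  (map_mx Num.conj M)^T.

Definition is_hermitian {R : realType} n (M : 'M[R[i]]_n) : Prop := adjmx M = M.

Definition over_field {R : realType} (real_case : bool) m n (M : 'M[R[i]]_(m, n)) : Prop :=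
  real_case -> M \is a mxOver Num.real.

Definition is_ordered_spectrum {R : realType} n (M : 'M[R[i]]_n) (s : seq R) : Prop :=
  [/\ size s = n, sorted (fun x y => y <= x) s &
      char_poly M = \prod_(x <- s) ('X - (x%:C)%C%:P)].

Definition spectrum {R : realType} n (M : 'M[R[i]]_n) : seq R :=
  xget (nseq n 0) (is_ordered_spectrum M).

(* lam M k = lambda_k(M), 1-based: lambda_1(M) >= ... >= lambda_n(M) *)
Definition lam {R : realType} n (M : 'M[R[i]]_n) (k : nat) : R :=
  nth 0 (spectrum M) k.-1.

Definition emp_integral {R : realType} n (M : 'M[R[i]]_n) (f : R -> R) : R :=
  n%:R^-1 * \sum_(i < n) f (lam M i.+1).

Definition cauchyG {R : realType} (mu : probability R R) (z : R) : R :=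
  Rintegral mu setT (fun t => (z - t)^-1).

Definition vnorm {R : realType} n (x : 'cV[R[i]]_n) : R :=
  Num.sqrt (\sum_(i < n) complex.Re (x i 0 * Num.conj (x i 0))).

Definition kerc {R : realType} n (A : 'M[R[i]]_n) : set 'cV[R[i]]_n :=
  [set x | A *m x = 0].

Definition orth_proj {R : realType} n (F : set 'cV[R[i]]_n) (x : 'cV[R[i]]_n) : 'cV[R[i]]_n :=
  xget 0 [set y | F y /\ forall f, F f -> adjmx f *m (x - y) = 0].

Definition proj_norm {R : realType} n (x : 'cV[R[i]]_n) (F : set 'cV[R[i]]_n) : R :=
  vnorm (orth_proj F x).

(* Borel sigma-algebra on n x n complex matrices: generated by the real and
   imaginary parts of the entries *)
Definition mx_gen {R : realType} n : set (set 'M[R[i]]_n) :=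
  [set A | exists (i j : 'I_n) (B : set R), measurable B /\
     (A = [set M : 'M[R[i]]_n | B (complex.Re (M i j))] \/ A = [set M : 'M[R[i]]_n | B (complex.Im (M i j))])].

Definition mx_measurable {R : realType} n : set (set 'M[R[i]]_n) := <<s @mx_gen R n >>.

Definition random_mx {R : realType} {d} {T : measurableType d} n (X : T -> 'M[R[i]]_n) : Prop :=
  forall A, mx_measurable A -> measurable (X @^-1` A).

Definition conj_invariant {R : realType} {d} {T : measurableType d}
    (real_case : bool) (P : probability T R) n (X : T -> 'M[R[i]]_n) : Prop :=
  forall U : 'M[R[i]]_n, U \is unitarymx -> over_field real_case U ->
  forall A, mx_measurable A ->
    P (X @^-1` A) = P ((fun w => U *m X w *m adjmx U) @^-1` A).

Definition cum {R : realType} (p : nat -> R) (k : nat) : R := \sum_(1 <= i < k.+1) p i.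

Definition ceiln {R : realType} (n : nat) (c : R) : nat := `|Num.ceil (n%:R * c)|%N.

(* Main.v *)
Require Import Defs.
From HB Require Import structures.
From mathcomp Require Import all_boot all_order all_algebra all_fingroup.
From mathcomp Require Import all_classical all_reals all_analysis.
From mathcomp Require Import complex.
From mathcomp Require Import measurable_realfun.
From mathcomp Require Import ring lra zify.
Set Implicit Arguments.
Unset Strict Implicit.
Unset Printing Implicit Defensive.
Import Order.TTheory GRing.Theory Num.Theory.
Import numFieldNormedType.Exports.
Import spectral.
Local Open Scope ring_scope.
Local Open Scope classical_set_scope.

(** Write [Pn = theta v v^*] with [v] a unit vector, let [lambda_i] be the eigenvalues of
    [Xn], [q_i] the squared moduli of the coordinates of [v] in an eigenbasis of [Xn], and
    [zeta] the eigenvalue of [Xn + Pn] under study, with unit eigenvector [u].  In the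
    eigenbasis, [(zeta - lambda_i) u_i = theta <v, u> v_i].  Hence, for every [eta > 0],
    [theta^2 |<v, u>|^2 \sum_i q_i / ((zeta - lambda_i)^2 + eta^2) <= 1], and, when [<v, u>]
    does not vanish and [zeta] is not an eigenvalue of [Xn],
    [\sum_i q_i / (zeta - lambda_i) = 1 / theta].

    The spectral measures [\sum_i q_i delta_(lambda_i)] have almost surely the same limit as
    the empirical spectral measures.  Indeed, by invariance, the fourth moment of
    [v^* (z - Xn)^-1 v - n^-1 tr (z - Xn)^-1] does not change when [v] is replaced with any
    normalized sign vector; averaging over all sign vectors turns it into the fourth moment
    of a Rademacher chaos of degree two, which is [O(n^-2)].  This is summable, and no Haar
    measure is needed.

    By interlacing, [zeta] asymptotically lies in the gap between [b_j] and [a_(j-1)].  The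
    secular equation and the monotonicity of Stieltjes transforms exclude any limit point
    inside the gap; and near its ends the first inequality forces [<v, u>] to vanish, because
    an infinite derivative of the Cauchy transform means that
    [\int 1 / ((rho - t)^2 + eta^2) dmuX(t)] is unbounded as [eta] tends to [0]. *)

(** * Spectral theorem and interlacing *)

Lemma adjmxM (R : realType) m n p (A : 'M[R[i]]_(m, n)) (B : 'M[R[i]]_(n, p)) :
  adjmx (A *m B) = adjmx B *m adjmx A.
Proof. by rewrite /adjmx map_mxM trmx_mul. Qed.

Lemma adjmxK (R : realType) m n (A : 'M[R[i]]_(m, n)) : adjmx (adjmx A) = A.
Proof. by apply/matrixP => i j; rewrite !mxE conjCK. Qed.

Lemma adjmxZ (R : realType) m n (c : R[i]) (A : 'M[R[i]]_(m, n)) :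
  adjmx (c *: A) = Num.conj c *: adjmx A.
Proof. by apply/matrixP => i j; rewrite !mxE rmorphM. Qed.

Lemma unitarymx_adjP (R : realType) n (U : 'M[R[i]]_n) :
  U \is unitarymx -> U *m adjmx U = 1%:M /\ adjmx U *m U = 1%:M.
Proof.
move=> /unitarymxP; rewrite -map_trmx => h; split=> //.
exact: mulmx1C.
Qed.

Lemma adj_unitarymx (R : realType) n (U : 'M[R[i]]_n) :
  U *m adjmx U = 1%:M -> U \is unitarymx.
Proof. by move=> h; apply/unitarymxP; rewrite -map_trmx. Qed.

Lemma char_poly_unitary_conj (R : realType) n (W D : 'M[R[i]]_n) :
  adjmx W *m W = 1%:M -> char_poly (adjmx W *m D *m W) = char_poly D.
Proof.
move=> h; rewrite /char_poly /char_poly_mx.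
have e : 'X%:M - map_mx polyC (adjmx W *m D *m W) =
  map_mx polyC (adjmx W) *m ('X%:M - map_mx polyC D) *m map_mx polyC W :> 'M[{poly R[i]}]_n.
  rewrite !map_mxM mulmxBr mulmxBl; congr (_ - _).
  by rewrite mul_mx_scalar -scalemxAl -map_mxM h map_mx1 scalemx1.
by rewrite e !det_mulmx mulrAC -det_mulmx -map_mxM h map_mx1 det1 mul1r.
Qed.

Lemma char_poly_diag (R : realType) n (d : 'rV[R[i]]_n) :
  char_poly (diag_mx d) = \prod_(i < n) ('X - (d 0 i)%:P).
Proof.
rewrite char_poly_trig ?diag_mx_is_trig//.
by apply: eq_bigr => i _; rewrite mxE eqxx mulr1n.
Qed.

(** [spectrum] is picked by [xget], so it is meaningful only once some ordered list of eigenvalues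
    is exhibited. Sorting the diagonal given by the spectral theorem exhibits one, and unique
    factorization of the characteristic polynomial makes the picked list a permutation of that
    diagonal. *)
Lemma hermitian_ordered_spectrum (R : realType) n (M : 'M[R[i]]_n) :
  is_hermitian M -> exists (W : 'M[R[i]]_n) (d : 'rV[R]_n),
  [/\ W *m adjmx W = 1%:M, adjmx W *m W = 1%:M,
  M = adjmx W *m diag_mx (map_mx (real_complex R) d) *m W
  & perm_eq (spectrum M) [seq d 0 i | i <- enum 'I_n] /\ is_ordered_spectrum M (spectrum M)].
Proof.
move=> hM.
have hs : M \is hermsymmx.
  by apply/is_hermitianmxP; rewrite expr0 scale1r -map_trmx; apply/esym.
have /orthomx_spectralP e := hermitian_normalmx hs.
have hd := hermitian_spectral_diag_real hs.
set W := spectralmx M; have [W1 W2] := unitarymx_adjP (spectral_unitarymx M).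
set d := map_mx (@complex.Re R) (spectral_diag M).
have dE : map_mx (real_complex R) d = spectral_diag M.
  apply/matrixP => i j; rewrite !mxE; apply: RRe_real.
  by move/mxOverP: hd => /(_ i j).
have MW : M = adjmx W *m diag_mx (map_mx (real_complex R) d) *m W.
  by rewrite dE {1}e invmx_unitary ?spectral_unitarymx// -map_trmx.
have cM : char_poly M = \prod_(x <- [seq d 0 i | i <- enum 'I_n]) ('X - (x%:C)%C%:P).
  rewrite MW char_poly_unitary_conj// char_poly_diag big_map big_enum/=.
  by apply: eq_bigr => i _; rewrite !mxE.
have os : is_ordered_spectrum M (spectrum M).
  rewrite /spectrum; case: xgetP => // /(_ (sort (fun x y : R => y <= x) [seq d 0 i | i <- enum 'I_n])) [].
  split.
  - by rewrite size_sort size_map size_enum_ord.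
  - by apply: sort_sorted => x y; rewrite orbC le_total.
  - by rewrite cM; apply: perm_big; rewrite perm_sym perm_sort.
exists W, d; split => //; split => //.
case: os => _ _ c2; rewrite cM in c2.
rewrite perm_sym; apply: (perm_map_inj (@complexI R)); apply: prod_XsubC_eq.
by rewrite !big_map in c2 *; rewrite c2.
Qed.

Lemma lam_sorted (R : realType) n (M : 'M[R[i]]_n) (i j : nat) :
  is_hermitian M -> (i <= j)%N -> (j < n)%N -> lam M j.+1 <= lam M i.+1.
Proof.
move=> /hermitian_ordered_spectrum[W [d [_ _ _ [_ [sz so _]]]]] ij jn.
rewrite /lam /=.
have tr : transitive (fun x y : R => y <= x) by move=> x y z; move=> /[swap]; exact: le_trans.
have rf : reflexive (fun x y : R => y <= x) by move=> x /=.
by apply: (sorted_leq_nth tr rf 0 so); rewrite ?inE ?sz// (leq_ltn_trans ij).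
Qed.

(** [W *m x] lists the coordinates of [x] in an orthonormal eigenbasis, ordered so that coordinate
    [i] belongs to [lam M i.+1]. *)
Definition eigenbasis (R : realType) n (M W : 'M[R[i]]_n) : Prop :=
  [/\ W *m adjmx W = 1%:M, adjmx W *m W = 1%:M &
   M = adjmx W *m diag_mx (\row_(i < n) ((lam M i.+1)%:C)%C) *m W].

(** The spectral theorem yields the eigenvalues in no particular order; permuting the rows of the
    unitary matrix puts them in the order of [spectrum]. *)
Lemma hermitian_eigenbasis (R : realType) n (M : 'M[R[i]]_n) :
  is_hermitian M -> exists W, eigenbasis M W.
Proof.
move=> /hermitian_ordered_spectrum[W [d [W1 W2 MW [pe [sz so _]]]]].
have /tuple_permP[s hs] : perm_eq (spectrum M) [tuple d 0 i | i < n] by [].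
have lamE (i : 'I_n) : lam M i.+1 = d 0 (s i).
  rewrite /lam/= hs (nth_map i) ?size_enum_ord//=.
  by rewrite nth_ord_enum tnth_map tnth_ord_tuple.
exists (row_perm s W).
have aW : adjmx (row_perm s W) = col_perm s (adjmx W).
  by apply/matrixP => i j; rewrite !mxE.
have Wp : row_perm s W = perm_mx s *m W by rewrite row_permE.
have aWp : adjmx (row_perm s W) = adjmx W *m perm_mx s^-1.
  by rewrite aW col_permE.
split.
- by rewrite aWp Wp mulmxA -(mulmxA _ W) W1 mulmx1 -perm_mxM mulgV perm_mx1.
- by rewrite aWp Wp mulmxA -(mulmxA _ (perm_mx s^-1)) -perm_mxM mulVg perm_mx1 mulmx1.
- rewrite aWp Wp {1}MW !mulmxA; congr (_ *m _); rewrite -!mulmxA; congr (_ *m _).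
  have -> : (\row_i ((lam M i.+1)%:C)%C) = col_perm s (map_mx (real_complex R) d).
    by apply/rowP => k; rewrite !mxE lamE.
  rewrite -[X in _ *m (_ *m perm_mx X)]invgK -col_permE -row_permE; apply/matrixP => i j; rewrite !mxE !permKV.
  by rewrite (inj_eq (@perm_inj _ s^-1)) .
Qed.

(** The squared modulus, valued in [R] rather than [R[i]] so that inequalities stay in the real
    field. *)
Definition sqn (R : realType) (z : R[i]) : R := complex.Re z ^+ 2 + complex.Im z ^+ 2.

Lemma sqn_ge0 (R : realType) (z : R[i]) : 0 <= sqn z.
Proof. by rewrite addr_ge0 ?sqr_ge0. Qed.

Lemma conj_mul_self (R : realType) (z : R[i]) : Num.conj z * z = ((sqn z)%:C)%C.
Proof.
case: z => a b; rewrite /sqn; apply/eqP; rewrite eq_complex /=.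
by apply/andP; split; apply/eqP; ring.
Qed.

Lemma sqn_eq0 (R : realType) (z : R[i]) : (sqn z == 0) = (z == 0).
Proof.
case: z => a b; rewrite /sqn eq_complex /=.
by rewrite paddr_eq0 ?sqr_ge0// !sqrf_eq0.
Qed.

Lemma sqnM (R : realType) (z w : R[i]) : sqn (z * w) = sqn z * sqn w.
Proof. by case: z w => [a b] [c e]; rewrite /sqn /=; ring. Qed.

Lemma sqn_real (R : realType) (x : R) : sqn ((x%:C)%C : R[i]) = x ^+ 2.
Proof. by rewrite /sqn /= expr0n addr0. Qed.

Lemma real_complex_sum (R : realType) (I : Type) (s : seq I) (P : pred I) (F : I -> R) :
  ((\sum_(i <- s | P i) F i)%:C)%C = \sum_(i <- s | P i) ((F i)%:C)%C :> R[i].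
Proof. exact: (raddf_sum (real_complex R)). Qed.

Lemma parseval (R : realType) n (W : 'M[R[i]]_n) (x y : 'cV[R[i]]_n) :
  adjmx W *m W = 1%:M ->
  (adjmx x *m y) 0 0 = \sum_(i < n) Num.conj ((W *m x) i 0) * (W *m y) i 0.
Proof.
move=> W2; have -> : adjmx x *m y = adjmx (W *m x) *m (W *m y).
  by rewrite adjmxM mulmxA -(mulmxA _ _ W) W2 mulmx1.
by rewrite mxE; apply: eq_bigr => i _; rewrite !mxE.
Qed.

Lemma parseval_sqn (R : realType) n (W : 'M[R[i]]_n) (x : 'cV[R[i]]_n) :
  adjmx W *m W = 1%:M ->
  (adjmx x *m x) 0 0 = ((\sum_(i < n) sqn ((W *m x) i 0))%:C)%C.
Proof.
move=> W2; rewrite (parseval _ _ W2) real_complex_sum.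
by apply: eq_bigr => i _; rewrite conj_mul_self.
Qed.

Lemma quad_form_eigenbasis (R : realType) n (M W : 'M[R[i]]_n) (x : 'cV[R[i]]_n) :
  eigenbasis M W ->
  (adjmx x *m M *m x) 0 0 = ((\sum_(i < n) lam M i.+1 * sqn ((W *m x) i 0))%:C)%C.
Proof.
move=> [_ _ MW]; have -> : adjmx x *m M *m x = adjmx (W *m x) *m
   (diag_mx (\row_(i < n) ((lam M i.+1)%:C)%C) *m (W *m x)).
  by rewrite {1}MW adjmxM !mulmxA.
rewrite mxE real_complex_sum; apply: eq_bigr => i _.
by rewrite mul_diag_mx !mxE mulrCA -[X in _ * X]/(_ * _) conj_mul_self -rmorphM.
Qed.

Lemma wide_kernel (F : fieldType) m n (K : 'M[F]_(m, n)) :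
  (m < n)%N -> exists2 x : 'cV[F]_n, x != 0 & K *m x = 0.
Proof.
move=> mn; have : kermx K^T != 0.
  rewrite -mxrank_eq0 mxrank_ker subn_eq0 -ltnNge mxrank_tr.
  exact: leq_ltn_trans (rank_leq_row K) mn.
move=> /matrix0Pn[i [j ij]]; exists (row i (kermx K^T))^T.
  apply: contraNneq ij => /(congr1 (fun z : 'cV_n => z j 0)).
  by rewrite [LHS]mxE [LHS]mxE [RHS]mxE => ->.
by apply: trmx_inj; rewrite trmx_mul trmxK -row_mul mulmx_ker row0 trmx0.
Qed.

(* A nonzero vector killed by [N], orthogonal to the first [k] eigenvectors of [A]
   and to the last [n - k - r - 1] eigenvectors of [B], exists by counting. *)
Lemma interlacing (R : realType) n (A B : 'M[R[i]]_n) (k r : nat) (N : 'M[R[i]]_(r, n)) :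
  is_hermitian A -> is_hermitian B -> (k + r < n)%N ->
  (forall x : 'cV[R[i]]_n, N *m x = 0 ->
    complex.Re ((adjmx x *m B *m x) 0 0) <= complex.Re ((adjmx x *m A *m x) 0 0)) ->
  lam B (k + r).+1 <= lam A k.+1.
Proof.
move=> hA hB krn H.
have [WA eA] := hermitian_eigenbasis hA; have [WB eB] := hermitian_eigenbasis hB.
have kn : (k <= n)%N by lia.
have ln : (n - (k + r).+1 <= n)%N by lia.
(* The stacked matrix has [k + r + (n - (k + r).+1) = n - 1] rows, one fewer than columns. *)
have [x x0 Kx] : exists2 x : 'cV[R[i]]_n, x != 0 &
  col_mx (rowsub (widen_ord kn) WA) (col_mx N (rowsub (fun i => rev_ord (widen_ord ln i)) WB)) *m x = 0.
  by apply: wide_kernel; lia.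
move: Kx; rewrite !mul_col_mx => /eqP; rewrite !col_mx_eq0 => /and3P[/eqP KA /eqP KN /eqP KB].
have zA (i : 'I_n) : (i < k)%N -> (WA *m x) i 0 = 0.
  move=> ik; have := congr1 (fun z : 'cV_k => z (Ordinal ik) 0) KA.
  rewrite mul_rowsub_mx [LHS]mxE [RHS]mxE => <-; congr ((WA *m x) _ 0).
  exact: val_inj.
have zB (i : 'I_n) : (k + r < i)%N -> (WB *m x) i 0 = 0.
  move=> ik; have ii : (n - i.+1 < n - (k + r).+1)%N by have := ltn_ord i; lia.
  have := congr1 (fun z : 'cV_(n - (k + r).+1) => z (Ordinal ii) 0) KB.
  rewrite mul_rowsub_mx [LHS]mxE [RHS]mxE => <-; congr ((WB *m x) _ 0).
  by apply: val_inj => /=; have := ltn_ord i; lia.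
have := H _ KN; rewrite (quad_form_eigenbasis x eA) (quad_form_eigenbasis x eB) /=.
set sA := \sum_(i < n) _; set sB := \sum_(i < n) _ => le.
have [_ WA2 _] := eA; have [_ WB2 _] := eB.
have nE : \sum_(i < n) sqn ((WA *m x) i 0) = \sum_(i < n) sqn ((WB *m x) i 0).
  by apply: complexI; rewrite -(parseval_sqn _ WA2) -(parseval_sqn _ WB2).
have n0 : 0 < \sum_(i < n) sqn ((WA *m x) i 0).
  rewrite lt_neqAle sumr_ge0 ?andbT; last by move=> *; exact: sqn_ge0.
  rewrite eq_sym; apply: contra x0 => /eqP e; apply/eqP.
  have : WA *m x = 0.
    apply/matrixP => i j; rewrite ord1 [RHS]mxE; apply/eqP; rewrite -sqn_eq0.
    have := @psumr_eq0P _ _ xpredT (fun i => sqn ((WA *m x) i 0)) => -> //.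
    by move=> *; exact: sqn_ge0.
  by move=> /(congr1 (mulmx (adjmx WA))); rewrite mulmxA WA2 mul1mx mulmx0.
(* Multiplied by the squared norm of [x], the eigenvalue of [B] bounds its form from below, as only
   coordinates up to [k + r] survive; that of [A] bounds its form from above, as only coordinates
   from [k] on survive. *)
rewrite -(ler_pM2r n0) {1}nE !mulr_sumr.
apply: (le_trans _ (le_trans le _)).
  apply: ler_sum => i _; have [ik|ik] := leqP i (k + r).
    by rewrite ler_wpM2r ?sqn_ge0// lam_sorted.
  by rewrite zB// sqn_real expr0n /= !mulr0.
apply: ler_sum => i _; have [ik|ik] := ltnP i k.
  by rewrite zA// sqn_real expr0n /= !mulr0.
by rewrite ler_wpM2r ?sqn_ge0// lam_sorted.
Qed.

(** * Rank one matrices and unit vectors *)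

Lemma adj_mul_self (R : realType) n (v : 'cV[R[i]]_n) :
  adjmx v *m v = ((\sum_(i < n) sqn (v i 0))%:C)%C%:M.
Proof.
rewrite [LHS]mx11_scalar; congr (_%:M); rewrite mxE real_complex_sum.
by apply: eq_bigr => i _; rewrite !mxE conj_mul_self.
Qed.

Lemma sum_sqn_gt0 (R : realType) n (v : 'cV[R[i]]_n) :
  v != 0 -> 0 < \sum_(i < n) sqn (v i 0).
Proof.
move=> v0; rewrite lt_neqAle sumr_ge0 ?andbT; last by move=> *; exact: sqn_ge0.
rewrite eq_sym; apply: contraNneq v0 => /eqP; rewrite psumr_eq0; last by move=> *; exact: sqn_ge0.
move=> /allP h; apply/eqP/matrixP => i j; rewrite ord1 mxE; apply/eqP.
by rewrite -sqn_eq0; exact: (h i (mem_index_enum i)).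
Qed.

Lemma over_field_adj (R : realType) rc m n (M : 'M[R[i]]_(m, n)) :
  over_field rc M -> over_field rc (adjmx M).
Proof.
move=> h r; have /mxOverP rM := h r; apply/mxOverP => i j; rewrite !mxE.
by rewrite (CrealP (rM _ _)) rM.
Qed.

Lemma conjC_realc (R : realType) (x : R) : Num.conj ((x%:C)%C : R[i]) = (x%:C)%C.
Proof. exact: (@conjc_real R x). Qed.

Lemma realc_real (R : realType) (x : R) : ((x%:C)%C : R[i]) \is Num.real.
Proof. by apply/complex_realP; exists x. Qed.

(** The row space is spanned by any nonzero row [g], which is therefore a left eigenvector for
    [theta]. By symmetry its adjoint [q] is a right eigenvector, so [P] is proportional to
    [q *m adjmx q], and normalizing [q] gives [v]. *)
Lemma rank1_hermitian (R : realType) n (P : 'M[R[i]]_n) (rc : bool) (theta : R) :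
  0 < theta ->
  is_hermitian P -> over_field rc P -> \rank P = 1%N -> eigenvalue P (theta%:C)%C ->
  exists v : 'cV[R[i]]_n, [/\ adjmx v *m v = 1%:M, over_field rc v &
    P = (theta%:C)%C *: (v *m adjmx v)].
Proof.
move=> th0 hP rP r1 /eigenvalueP[r rPr r0].
have [s [t Pst]] : exists (s : 'cV[R[i]]_n) (t : 'rV[R[i]]_n), P = s *m t.
  move: (col_base P) (row_base P) (mulmx_base P); rewrite r1 => s t <-.
  by exists s, t.
have P0 : P != 0 by rewrite -mxrank_eq0 r1.
(* A row of [P] replaces the abstract factor [t] because it is real whenever [P] is. *)
have /matrix0Pn[k [l kl]] := P0.
have g0 : row k P != 0.
  by apply: contraNneq kl => /(congr1 (fun z : 'rV_n => z 0 l)); rewrite [LHS]mxE [RHS]mxE => ->.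
have gE : row k P = s k 0 *: t.
  by apply/rowP => j; rewrite Pst !mxE big_ord1.
have gr : over_field rc (row k P).
  by move=> h; have /mxOverP rM := rP h; apply/mxOverP => i j; rewrite mxE.
set g := row k P in g0 gE gr *.
have sk0 : s k 0 != 0 by apply: contraNneq g0 => e; rewrite gE e scale0r.
have tE : t = (s k 0)^-1 *: g by rewrite gE scalerA mulVf// scale1r.
have Psg : P = ((s k 0)^-1 *: s) *m g by rewrite Pst tE -scalemxAr -scalemxAl.
set s' := _ *: s in Psg.
have thC0 : (theta%:C)%C != 0 :> R[i] by rewrite (inj_eq (@complexI R) theta 0) gt_eqF.
have gP : g *m P = (theta%:C)%C *: g.
  move: rPr; rewrite Psg mulmxA [r *m s']mx11_scalar mul_scalar_mx => e.
  have c0 : (r *m s') 0 0 != 0.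
    apply: contraNneq r0 => c0; move/esym/eqP: e; rewrite c0 scale0r scaler_eq0.
    by rewrite (negPf thC0).
  have rE : r = ((theta%:C)%C^-1 * (r *m s') 0 0) *: g.
    by rewrite -scalerA e scalerA mulVf// scale1r.
  have d0 : ((theta%:C)%C^-1 * (r *m s') 0 0) != 0 by rewrite mulf_neq0 ?invr_eq0.
  apply: (scalerI d0); rewrite [RHS]scalerA [_ * (theta%:C)%C]mulrC -[RHS]scalerA -rE.
  by rewrite scalemxAl -rE mulmxA [r *m s']mx11_scalar mul_scalar_mx e.
set q := adjmx g.
have gq : g = adjmx q by rewrite adjmxK.
have q0 : q != 0 by apply: contraNneq g0 => e; rewrite gq e /adjmx map_mx0 trmx0.
set N := \sum_(i < n) sqn (q i 0); have N0 : 0 < N := sum_sqn_gt0 q0.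
have NC0 : (N%:C)%C != 0 :> R[i] by rewrite (inj_eq (@complexI R) N 0) gt_eqF.
have Pq : P *m q = (theta%:C)%C *: q.
  by rewrite -[P in LHS]hP -adjmxM gP adjmxZ conjC_realc.
(* Comparing [P *m q] computed from [P = s' *m g] with the eigenvalue equation determines [s']. *)
have s'E : s' = ((N%:C)%C^-1 * (theta%:C)%C) *: q.
  rewrite -scalerA -Pq {1}Psg -mulmxA gq adj_mul_self mul_mx_scalar scalerA.
  by rewrite -/N mulVf// scale1r.
exists (((Num.sqrt N)^-1%:C)%C *: q); split.
- rewrite adjmxZ conjC_realc -scalemxAl -scalemxAr scalerA adj_mul_self -/N.
  rewrite scale_scalar_mx -!rmorphM/= -expr2 exprVn sqr_sqrtr ?ltW// mulVf ?gt_eqF//.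
- move=> h; have /mxOverP qr := over_field_adj gr h.
  by apply/mxOverP => i j; rewrite mxE rpredM// realc_real.
- rewrite Psg s'E adjmxZ conjC_realc -!scalemxAl -scalemxAr !scalerA -gq; congr (_ *: _).
  rewrite -!mulrA [LHS]mulrC; congr (_ * _).
  by rewrite -rmorphM -expr2 exprVn sqr_sqrtr ?ltW// [RHS]fmorphV.
Qed.

(** The kernel is the line spanned by the unit vector [v], so [u] projects to [v *m (adjmx v *m u)].
    As [orth_proj] is picked by [xget], both existence and uniqueness of the projection are
    checked. *)
Lemma proj_norm_rank1 (R : realType) n (u v : 'cV[R[i]]_n) (theta : R) :
  theta != 0 -> adjmx v *m v = 1%:M ->
  proj_norm u (kerc ((theta%:C)%C%:M - (theta%:C)%C *: (v *m adjmx v))) =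
    Num.sqrt (sqn ((adjmx v *m u) 0 0)).
Proof.
move=> th0 v1; set K := kerc _.
have thC0 : (theta%:C)%C != 0 :> R[i] by rewrite (inj_eq (@complexI R) theta 0).
have KE y : K y <-> y = v *m (adjmx v *m y).
  rewrite /K /kerc /= mulmxBl mul_scalar_mx -scalemxAl -scalerBr mulmxA.
  split=> [/eqP|->]; last by rewrite !mulmxA -(mulmxA v _ v) v1 mulmx1 subrr scaler0.
  by rewrite scaler_eq0 (negPf thC0)/= subr_eq0 => /eqP.
have oE : orth_proj K u = v *m (adjmx v *m u).
  rewrite /orth_proj; case: xgetP => [y _ [Ky yo]|/(_ (v *m (adjmx v *m u)))[]].
    have Kv : K v by apply/KE; rewrite v1 mulmx1.
    have /eqP := yo v Kv; rewrite mulmxBr subr_eq0 => /eqP ->.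
    exact/KE.
  split; first by apply/KE; rewrite !mulmxA -(mulmxA v _ v) v1 mulmx1.
  move=> f /KE ->; rewrite !adjmxM adjmxK mulmxBr -!mulmxA [adjmx v *m (v *m _)]mulmxA v1.
  by rewrite mul1mx subrr.
rewrite /proj_norm oE /vnorm; set c := (adjmx v *m u) 0 0.
have -> : adjmx v *m u = c%:M by exact: mx11_scalar.
rewrite mul_mx_scalar; congr Num.sqrt.
have -> : \sum_(i < n) complex.Re ((c *: v) i 0 * Num.conj ((c *: v) i 0)) =
   sqn c * \sum_(i < n) sqn (v i 0).
  rewrite mulr_sumr; apply: eq_bigr => i _.
  by rewrite mulrC conj_mul_self /= mxE sqnM.
have /matrixP/(_ 0 0) := v1; rewrite adj_mul_self !mxE eqxx !mulr1n.
by move=> /(@complexI R) ->; rewrite mulr1.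
Qed.

Lemma scale11 (R : realType) m (v : 'cV[R[i]]_m) (a : 'M[R[i]]_1) : v *m a = a 0 0 *: v.
Proof. by rewrite [a in LHS]mx11_scalar mul_mx_scalar. Qed.

(* The unit scalar [c] makes [c *: w] and [v] have a real inner product, so that the
   Householder reflection exchanging them exists also in the complex case. *)
Lemma unit_vectors_conjugate (R : realType) n rc (v w : 'cV[R[i]]_n) :
  adjmx v *m v = 1%:M -> adjmx w *m w = 1%:M -> over_field rc v -> over_field rc w ->
  exists (U : 'M[R[i]]_n) (c : R[i]),
    [/\ U \is unitarymx, over_field rc U, sqn c = 1 & adjmx U *m v = c *: w].
Proof.
move=> v1 w1 rv rw; set a := (adjmx w *m v) 0 0.
have ra : rc -> a \is Num.real.
  move=> h; rewrite /a mxE rpred_sum// => i _.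
  have /mxOverP wr := over_field_adj rw h; have /mxOverP vr := rv h.
  by rewrite rpredM.
have [c [c1 rcc [rho cr]]] : exists c : R[i], [/\ sqn c = 1, rc -> c \is Num.real &
    exists rho : R, Num.conj c * a = (rho%:C)%C].
  have [a0|a0] := eqVneq a 0.
    exists 1; split; first by rewrite sqn_real expr1n.
      by move=> _; exact: rpred1.
    by exists 0; rewrite a0 mulr0.
  have na : 0 < Num.sqrt (sqn a) by rewrite sqrtr_gt0 lt_neqAle sqn_ge0 andbT eq_sym sqn_eq0.
  (* The phase of [a] turns the inner product into the modulus of [a]. *)
  exists (((Num.sqrt (sqn a))^-1%:C)%C * a); split.
  - by rewrite sqnM sqn_real exprVn sqr_sqrtr ?sqn_ge0// mulVf// sqn_eq0.
  - by move=> h; rewrite rpredM ?realc_real ?ra.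
  - exists ((Num.sqrt (sqn a))^-1 * sqn a).
    by rewrite [Num.conj _]rmorphM /= conjC_realc -mulrA conj_mul_self -rmorphM.
set w' := c *: w.
have w'1 : adjmx w' *m w' = 1%:M.
  rewrite adjmxZ -scalemxAl -scalemxAr scalerA w1 conj_mul_self c1.
  by rewrite scale1r.
have w'v : adjmx w' *m v = ((rho%:C)%C)%:M.
  rewrite adjmxZ -scalemxAl -cr [adjmx w *m v]mx11_scalar.
  by rewrite scale_scalar_mx.
have vw' : adjmx v *m w' = ((rho%:C)%C)%:M.
  by rewrite -[LHS]adjmxK adjmxM adjmxK w'v /adjmx map_scalar_mx tr_scalar_mx /= conjC_realc.
have rw' : over_field rc w'.
  move=> h; have /mxOverP wr := rw h.
  by apply/mxOverP => i j; rewrite mxE rpredM// rcc.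
(* When [w' = v] the reflection vector vanishes, and the identity matrix is taken instead. *)
have [e|e] := eqVneq w' v.
  exists 1%:M, c; split => //.
  - by apply: adj_unitarymx; rewrite mul1mx /adjmx map_mx1 trmx1.
  - by move=> h; apply/mxOverP => i j; rewrite mxE rpred_nat.
  - by rewrite /adjmx map_mx1 trmx1 mul1mx -/w' e.
set d := w' - v.
have d0 : d != 0 by rewrite subr_eq0.
have adjD : adjmx d = adjmx w' - adjmx v by rewrite /adjmx map_mxB linearB.
set N := \sum_(i < n) sqn (d i 0); have N0 : 0 < N := sum_sqn_gt0 d0.
have NC0 : (N%:C)%C != 0 :> R[i] by rewrite (inj_eq (@complexI R) N 0) gt_eqF.
have dd : adjmx d *m d = (N%:C)%C%:M by exact: adj_mul_self.
have NE : (N%:C)%C = 2 - 2 * (rho%:C)%C :> R[i].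
  have /matrixP/(_ 0 0) := dd; rewrite adjD mulmxBl !mulmxBr w'1 v1 w'v vw' !mxE eqxx !mulr1n.
  by move=> <-; ring.
have dv : adjmx d *m v = ((rho%:C)%C - 1)%:M.
  by rewrite adjD mulmxBl w'v v1 -raddfB.
set k := 2 / (N%:C)%C : R[i].
have kr : Num.conj k = k by rewrite /k fmorph_div /= rmorph_nat conjC_realc.
set U := 1%:M - k *: (d *m adjmx d).
have UU : adjmx U = U.
  rewrite /U /adjmx map_mxB linearB /= map_mx1 trmx1; congr (_ - _).
  by rewrite -/(adjmx _) adjmxZ adjmxM adjmxK kr.
exists U, c; split => //.
- apply: adj_unitarymx; rewrite UU {2}/U mulmxBr mulmx1 -scalemxAr {2}/U mulmxBl mul1mx.
  rewrite -scalemxAl !mulmxA -(mulmxA d _ d) dd mul_mx_scalar -scalemxAl scalerA.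
  have -> : k * (N%:C)%C = 2 by rewrite /k divfK.
  rewrite scalerBr scalerA /U -addrA -[RHS]addr0; congr (_ + _).
  by apply/matrixP => i j; rewrite !mxE; ring.
- move=> h; have /mxOverP wr := rw' h; have /mxOverP vr := rv h.
  have dr (i : 'I_n) : d i 0 \is Num.real by rewrite !mxE rpredB// -1?[c * _]/(_) ; have := wr i 0; rewrite mxE.
  apply/mxOverP => i j; rewrite !mxE big_ord1 !mxE rpredB ?rpred_nat// !rpredM//.
  + exact: rpred_nat.
  + by rewrite rpredV realc_real.
  + by have := dr i; rewrite !mxE.
  + by have := dr j; rewrite !mxE => drj; rewrite conj_Creal.
- rewrite UU mulmxBl mul1mx -scalemxAl -mulmxA dv mul_mx_scalar scalerA.
  (* Since [N = 2 - 2 * rho], the inner product of [d] with [v] is [- N / 2], and the reflection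
     sends [v] to [v + d = w']. *)
  have -> : k * ((rho%:C)%C - 1) = -1.
    apply: (mulIf NC0); rewrite /k mulrAC divfK// NE; ring.
  by rewrite scaleN1r opprK /d addrC subrK.
Qed.

(** * Resolvents *)

(** The inverse of [z%:M - M] in Cramer's form: its entries are visibly rational in those of [M],
    which gives measurability. *)
Definition resolvent (R : realType) n (z : R[i]) (M : 'M[R[i]]_n) : 'M[R[i]]_n :=
  (\det (z%:M - M))^-1 *: \adj (z%:M - M).

Lemma resolvent_unique (R : realType) n (z : R[i]) (M B : 'M[R[i]]_n) :
  (z%:M - M) *m B = 1%:M -> resolvent z M = B.
Proof.
move=> h; have [u _] := mulmx1_unit h.
have -> : resolvent z M = invmx (z%:M - M) by rewrite /invmx u.
by rewrite -[RHS](mulKmx u) h mulmx1.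
Qed.

Lemma nonreal_sub_neq0 (R : realType) (z : R[i]) (x : R) :
  complex.Im z != 0 -> z - (x%:C)%C != 0.
Proof.
by case: z => a b /= b0; rewrite eq_complex /= oppr0 addr0 (negPf b0) andbF.
Qed.

Lemma resolvent_eigenbasis (R : realType) n (z : R[i]) (M W : 'M[R[i]]_n) :
  complex.Im z != 0 -> eigenbasis M W ->
  (z%:M - M) *m resolvent z M = 1%:M /\
  resolvent z M =
    adjmx W *m diag_mx (\row_(i < n) (z - ((lam M i.+1)%:C)%C)^-1) *m W.
Proof.
move=> z0 [W1 W2 MW].
set B := adjmx W *m _ *m W.
have h : (z%:M - M) *m B = 1%:M.
  have -> : z%:M - M = adjmx W *m diag_mx (\row_(i < n) (z - ((lam M i.+1)%:C)%C)) *m W.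
    have zE : z%:M = adjmx W *m z%:M *m W by rewrite mul_mx_scalar -scalemxAl W2 scalemx1.
    rewrite {1}MW zE -mulmxBl -mulmxBr; congr (_ *m _ *m _).
    apply/matrixP => i j; rewrite !mxE; case: (i == j); rewrite ?mulr1n ?mulr0n//.
      by rewrite subr0.
  rewrite /B !mulmxA -(mulmxA _ W) W1 mulmx1 -(mulmxA (adjmx W)) mulmx_diag.
  have -> : \row_i ((\row_(i0 < n) (z - ((lam M i0.+1)%:C)%C)) 0 i *
      (\row_(i0 < n) (z - ((lam M i0.+1)%:C)%C)^-1) 0 i) = const_mx 1.
    by apply/rowP => i; rewrite !mxE mulfV// nonreal_sub_neq0.
  by rewrite diag_const_mx mulmx1.
by rewrite (resolvent_unique h).
Qed.

Lemma resolvent_conj (R : realType) n (z : R[i]) (M U : 'M[R[i]]_n) :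
  complex.Im z != 0 -> is_hermitian M -> U \is unitarymx ->
  resolvent z (U *m M *m adjmx U) = U *m resolvent z M *m adjmx U.
Proof.
move=> z0 hM uU; have [W eW] := hermitian_eigenbasis hM.
have [U1 U2] := unitarymx_adjP uU; have [h _] := resolvent_eigenbasis z0 eW.
apply: resolvent_unique.
have -> : z%:M - U *m M *m adjmx U = U *m (z%:M - M) *m adjmx U.
  by rewrite mulmxBr mulmxBl mul_mx_scalar -scalemxAl U1 scalemx1.
by rewrite !mulmxA -(mulmxA _ (adjmx U)) U2 mulmx1 -(mulmxA U) h mulmx1.
Qed.

Lemma resolvent_quad (R : realType) n (z : R[i]) (M W : 'M[R[i]]_n) (v : 'cV[R[i]]_n) :
  complex.Im z != 0 -> eigenbasis M W ->
  (adjmx v *m resolvent z M *m v) 0 0 =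
    \sum_(i < n) ((sqn ((W *m v) i 0))%:C)%C * (z - ((lam M i.+1)%:C)%C)^-1.
Proof.
move=> z0 eW; have [_ ->] := resolvent_eigenbasis z0 eW.
set D := diag_mx _.
have -> : adjmx v *m (adjmx W *m D *m W) *m v = adjmx (W *m v) *m (D *m (W *m v)).
  by rewrite adjmxM !mulmxA.
rewrite mxE; apply: eq_bigr => i _.
by rewrite mul_diag_mx !mxE mulrCA -[X in _ * X]/(_ * _) conj_mul_self mulrC.
Qed.

Lemma resolvent_trace (R : realType) n (z : R[i]) (M W : 'M[R[i]]_n) :
  complex.Im z != 0 -> eigenbasis M W ->
  \tr (resolvent z M) = \sum_(i < n) (z - ((lam M i.+1)%:C)%C)^-1.
Proof.
move=> z0 eW; have [_ ->] := resolvent_eigenbasis z0 eW.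
have [W1 _ _] := eW.
rewrite mxtrace_mulC mulmxA W1 mul1mx mxtrace_diag.
by apply: eq_bigr => i _; rewrite mxE.
Qed.

Lemma adj_diag (R : realType) n (d : 'rV[R[i]]_n) :
  adjmx (diag_mx d) = diag_mx (map_mx Num.conj d).
Proof. by rewrite /adjmx map_diag_mx tr_diag_mx. Qed.

Lemma adjmxE (R : realType) m n (A : 'M[R[i]]_(m, n)) i j : adjmx A i j = Num.conj (A j i).
Proof. by rewrite !mxE. Qed.

(** Unitary invariance of the Hilbert-Schmidt norm; it measures the coefficients of the chaos
    below. *)
Lemma resolvent_frobenius (R : realType) n (z : R[i]) (M W : 'M[R[i]]_n) :
  complex.Im z != 0 -> eigenbasis M W ->
  \sum_(i < n) \sum_(j < n) sqn (resolvent z M i j) =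
  \sum_(i < n) sqn ((z - ((lam M i.+1)%:C)%C)^-1).
Proof.
move=> z0 eW; apply: complexI; have [_ rE] := resolvent_eigenbasis z0 eW.
have [W1 W2 _] := eW.
set A := resolvent z M in rE *.
have -> : ((\sum_(i < n) \sum_(j < n) sqn (A i j))%:C)%C = \tr (A *m adjmx A).
  rewrite real_complex_sum; apply: eq_bigr => i _; rewrite mxE real_complex_sum.
  by apply: eq_bigr => j _; rewrite adjmxE mulrC conj_mul_self.
rewrite rE; set D := diag_mx _; rewrite !adjmxM adjmxK.
have -> : adjmx W *m D *m W *m (adjmx W *m (adjmx D *m W)) = adjmx W *m (D *m adjmx D *m W).
  by rewrite !mulmxA -(mulmxA _ W) W1 mulmx1.
rewrite mxtrace_mulC -(mulmxA _ W (adjmx W)) W1 mulmx1 adj_diag mulmx_diag mxtrace_diag real_complex_sum.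
by apply: eq_bigr => i _; rewrite !mxE mulrC conj_mul_self.
Qed.

(** The eigenvalue equation read in the eigenbasis of [X]. Nothing is divided, so [zeta] may also be
    an eigenvalue of [X]. *)
Lemma eigvec_coords (R : realType) n (X W : 'M[R[i]]_n) (u v : 'cV[R[i]]_n) (theta zeta : R) :
  eigenbasis X W ->
  (X + (theta%:C)%C *: (v *m adjmx v)) *m u = (zeta%:C)%C *: u ->
  forall i : 'I_n, ((zeta - lam X i.+1)%:C)%C * (W *m u) i 0 =
     (theta%:C)%C * (adjmx v *m u) 0 0 * (W *m v) i 0.
Proof.
move=> [W1 W2 XW] e i.
have WX : W *m X = diag_mx (\row_(i < n) ((lam X i.+1)%:C)%C) *m W.
  by rewrite {1}XW !mulmxA W1 mul1mx.
have := congr1 (fun z => (W *m z) i 0) e.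
rewrite mulmxDl mulmxDr mulmxA WX -scalemxAl -!scalemxAr -!mulmxA.
rewrite [v *m _]scale11 -scalemxAr mul_diag_mx ![_ i 0]mxE => e'.
rewrite rmorphB mulrBl -e' /= [(\row_i0 _) 0 i]mxE; ring.
Qed.

(** * Rademacher chaos *)

(* The [t]-th sign vector, [t < 2 ^ n], read off the binary digits of [t]. *)
Definition sign_vec (R : realType) (t k : nat) : R := (-1) ^+ odd (t %/ 2 ^ k).

Lemma sign_vec_sqr (R : realType) t k : (sign_vec R t k) ^+ 2 = 1.
Proof. by rewrite /sign_vec sqrr_sign. Qed.

(** With the next lemma: for [t < 2 ^ n], adding [2 ^ n] flips the sign of index [n] and keeps the
    earlier ones. This drives the inductions on [n]. *)
Lemma sign_vec_shift (R : realType) n t k : (k < n)%N ->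
  sign_vec R (2 ^ n + t) k = sign_vec R t k.
Proof.
move=> kn; rewrite /sign_vec.
have -> : (2 ^ n = 2 ^ (n - k) * 2 ^ k)%N by rewrite -expnD subnK// ltnW.
rewrite divnMDl ?expn_gt0// oddD oddX.
by have -> : (n - k == 0)%N = false by lia.
Qed.

Lemma sign_vec_top (R : realType) n t : (t < 2 ^ n)%N ->
  sign_vec R t n = 1 /\ sign_vec R (2 ^ n + t) n = -1.
Proof.
move=> tn; rewrite /sign_vec divn_small// expr0; split => //.
by rewrite divnDl ?dvdnn// divnn expn_gt0/= divn_small.
Qed.

Lemma sum_sign_split (R : realType) n (F : nat -> R) :
  \sum_(0 <= t < 2 ^ n.+1) F t = \sum_(0 <= t < 2 ^ n) (F t + F (2 ^ n + t)%N).
Proof.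
rewrite expnS mul2n -addnn (big_cat_nat (leq0n _) (leq_addr (2 ^ n) (2 ^ n)))/=.
rewrite -{2}[(2 ^ n)%N]add0n big_addn addnK big_split/=; congr (_ + _).
by apply: eq_bigr => t _; rewrite addnC.
Qed.

(** Lagrange's identity: a double sum of squares equals twice the difference of the two sides. *)
Lemma cauchy_schwarz_sum (R : realType) (I : Type) (s : seq I) (f g : I -> R) :
  (\sum_(i <- s) f i * g i) ^+ 2 <= (\sum_(i <- s) f i ^+ 2) * (\sum_(i <- s) g i ^+ 2).
Proof.
have : 0 <= \sum_(i <- s) \sum_(j <- s) (f i * g j - f j * g i) ^+ 2.
  by apply: sumr_ge0 => i _; apply: sumr_ge0 => j _; exact: sqr_ge0.
have -> : \sum_(i <- s) \sum_(j <- s) (f i * g j - f j * g i) ^+ 2 =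
  2 * ((\sum_(i <- s) f i ^+ 2) * (\sum_(i <- s) g i ^+ 2)
   - (\sum_(i <- s) f i * g i) ^+ 2).
  have -> : forall a b c : R, 2 * (a * b - c ^+ 2) = a * b + b * a - 2 * (c * c) by move=> *; ring.
  rewrite !big_distrlr /= mulr_sumr -big_split/= -sumrB; apply: eq_bigr => i _.
  rewrite mulr_sumr -big_split/= -sumrB; apply: eq_bigr => j _; ring.
by rewrite pmulr_rge0// subr_ge0.
Qed.

(** Khinchin's inequality for exponents two and four, by induction: averaging over the last sign
    replaces [L] with [L + a n] and [L - a n], and odd powers of [a n] cancel. *)
Lemma linear_chaos (R : realType) n (a : nat -> R) :
  let L t := \sum_(0 <= k < n) a k * sign_vec R t k in
  let S := \sum_(0 <= k < n) a k ^+ 2 in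
  \sum_(0 <= t < 2 ^ n) L t ^+ 2 = 2 ^+ n * S /\
  \sum_(0 <= t < 2 ^ n) L t ^+ 4 <= 2 ^+ n * (3 * S ^+ 2).
Proof.
move=> L S; rewrite {}/L {}/S.
elim: n => [|n [IH2 IH4]]; first by rewrite expn0 !big_nat1 !big_geq// !expr0n /= !mulr0.
rewrite !sum_sign_split [\sum_(0 <= k < n.+1) a k ^+ 2]big_nat_recr//=.
set S := \sum_(0 <= k < n) a k ^+ 2 in IH2 IH4 *.
set L := fun t => \sum_(0 <= k < n) a k * sign_vec R t k.
have LE t : (t < 2 ^ n)%N ->
    \sum_(0 <= k < n.+1) a k * sign_vec R t k = L t + a n /\
    \sum_(0 <= k < n.+1) a k * sign_vec R (2 ^ n + t) k = L t - a n.
  move=> tn; have [e1 e2] := sign_vec_top R tn.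
  rewrite !big_nat_recr//= e1 e2 mulr1 mulrN1; split => //; congr (_ - _).
  by rewrite /L !big_nat; apply: eq_bigr => k /= kn; rewrite sign_vec_shift.
have e2 : \sum_(0 <= t < 2 ^ n)
     ((\sum_(0 <= k < n.+1) a k * sign_vec R t k) ^+ 2 +
      (\sum_(0 <= k < n.+1) a k * sign_vec R (2 ^ n + t) k) ^+ 2) =
   \sum_(0 <= t < 2 ^ n) (2 * (L t ^+ 2) + 2 * a n ^+ 2).
  by rewrite !big_nat; apply: eq_bigr => t /= tn; have [-> ->] := LE _ tn; ring.
have e4 : \sum_(0 <= t < 2 ^ n)
     ((\sum_(0 <= k < n.+1) a k * sign_vec R t k) ^+ 4 +
      (\sum_(0 <= k < n.+1) a k * sign_vec R (2 ^ n + t) k) ^+ 4) =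
   \sum_(0 <= t < 2 ^ n) (2 * (L t ^+ 4) + (12 * a n ^+ 2) * L t ^+ 2 + 2 * a n ^+ 4).
  by rewrite !big_nat; apply: eq_bigr => t /= tn; have [-> ->] := LE _ tn; ring.
have cE (c : R) : \sum_(0 <= t < 2 ^ n) c = 2 ^+ n * c.
  by rewrite sumr_const_nat subn0 -[LHS]mulr_natl natrX.
split.
  by rewrite e2 big_split/= cE -mulr_sumr IH2 [2 ^+ n.+1]exprS; ring.
rewrite e4 !big_split/= cE -!mulr_sumr IH2 [2 ^+ n.+1]exprS.
rewrite -/L in IH4.
have p0 : 0 <= 2 ^+ n :> R by rewrite exprn_ge0.
(* This is the slack of the induction step: [2 * 3 - 2 = 4] copies of [a n ^+ 4], the other terms
   being equal. *)
have : 0 <= 2 ^+ n * (a n ^+ 4 *+ 4) by rewrite mulr_ge0// mulrn_wge0// exprn_even_ge0.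
have : 2 * \sum_(0 <= i < 2 ^ n) L i ^+ 4 <= 2 * (2 ^+ n * (3 * S ^+ 2)) by rewrite ler_pM2l.
rewrite -mulr_natl; lra.
Qed.

(* Bonami's inequality for chaoses of degree two. *)
Lemma quadratic_chaos (R : realType) n (A : nat -> nat -> R) :
  let q t := \sum_(0 <= i < n) \sum_(0 <= j < n) A i j * (sign_vec R t i * sign_vec R t j)
    - \sum_(0 <= i < n) A i i in
  \sum_(0 <= t < 2 ^ n) q t ^+ 4 <=
    2 ^+ n * (108 * (\sum_(0 <= i < n) \sum_(0 <= j < n) A i j ^+ 2) ^+ 2).
Proof.
rewrite /=; elim: n => [|n IH].
  by rewrite expn0 !big_nat1 !big_geq// subr0 !expr0n/= !mulr0.
rewrite sum_sign_split.
set Nn := \sum_(0 <= i < n) \sum_(0 <= j < n) A i j ^+ 2 in IH.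
set q := fun t => \sum_(0 <= i < n) \sum_(0 <= j < n) A i j * (sign_vec R t i * sign_vec R t j)
    - \sum_(0 <= i < n) A i i.
rewrite -/q in IH.
set l := fun t => \sum_(0 <= i < n) (A i n + A n i) * sign_vec R t i.
set D := \sum_(0 <= i < n) (A i n ^+ 2 + A n i ^+ 2).
have D0 : 0 <= D by apply: sumr_ge0 => i _; rewrite addr_ge0 ?sqr_ge0.
have N0 : 0 <= Nn by apply: sumr_ge0 => i _; apply: sumr_ge0 => j _; exact: sqr_ge0.
have NE : Nn + D <= \sum_(0 <= i < n.+1) \sum_(0 <= j < n.+1) A i j ^+ 2.
  rewrite big_nat_recr//= [\sum_(0 <= j < n.+1) A n j ^+ 2]big_nat_recr//=.
  rewrite (eq_bigr (fun i => \sum_(0 <= j < n) A i j ^+ 2 + A i n ^+ 2)); last first.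
    by move=> i _; rewrite big_nat_recr.
  rewrite /D !big_split/= -/Nn; have := sqr_ge0 (A n n); lra.
(* The square of the last sign is removed by the diagonal sum, so that sign enters linearly: the
   form is [q] plus or minus the linear chaos [l]. *)
have qE t : (t < 2 ^ n)%N ->
  (\sum_(0 <= i < n.+1) \sum_(0 <= j < n.+1) A i j * (sign_vec R t i * sign_vec R t j)
    - \sum_(0 <= i < n.+1) A i i = q t + l t) /\
  (\sum_(0 <= i < n.+1) \sum_(0 <= j < n.+1) A i j * (sign_vec R (2 ^ n + t) i * sign_vec R (2 ^ n + t) j)
    - \sum_(0 <= i < n.+1) A i i = q t - l t).
  move=> tn; have [e1 e2] := sign_vec_top R tn.
  have gen (s s' : nat -> R) (c : R) : c ^+ 2 = 1 -> s' n = c -> (forall k, (k < n)%N -> s' k = s k) ->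
    \sum_(0 <= i < n.+1) \sum_(0 <= j < n.+1) A i j * (s' i * s' j) - \sum_(0 <= i < n.+1) A i i =
    (\sum_(0 <= i < n) \sum_(0 <= j < n) A i j * (s i * s j) - \sum_(0 <= i < n) A i i) +
     c * (\sum_(0 <= i < n) (A i n + A n i) * s i).
    move=> c2 sn sk; rewrite !big_nat_recr//= sn.
    have -> : \sum_(0 <= i < n) \sum_(0 <= j < n.+1) A i j * (s' i * s' j) =
       \sum_(0 <= i < n) \sum_(0 <= j < n) A i j * (s i * s j) + \sum_(0 <= i < n) c * (A i n * s i).
      rewrite -big_split/= !big_nat; apply: eq_bigr => i /= ilt; rewrite big_nat_recr//= sn sk//.
      congr (_ + _); last by ring.
      by rewrite !big_nat; apply: eq_bigr => j /= jlt; rewrite sk.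
    have -> : \sum_(0 <= j < n) A n j * (c * s' j) = \sum_(0 <= j < n) c * (A n j * s j).
      by rewrite !big_nat; apply: eq_bigr => j /= jlt; rewrite sk//; ring.
    rewrite -!mulr_sumr.
    have -> : \sum_(0 <= i < n) (A i n + A n i) * s i =
      \sum_(0 <= i < n) A i n * s i + \sum_(0 <= i < n) A n i * s i.
      by rewrite -big_split/=; apply: eq_bigr => i _; rewrite mulrDl.
    by rewrite -expr2 c2; ring.
  split.
    by rewrite (gen (sign_vec R t) _ 1) ?expr1n ?mul1r.
  rewrite (gen (sign_vec R t) _ (-1)) ?sqrrN ?expr1n ?mulN1r// => k kn.
  exact: sign_vec_shift.
have -> : \sum_(0 <= t < 2 ^ n)
   ((\sum_(0 <= i < n.+1) \sum_(0 <= j < n.+1) A i j * (sign_vec R t i * sign_vec R t j)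
    - \sum_(0 <= i < n.+1) A i i) ^+ 4 +
  (\sum_(0 <= i < n.+1) \sum_(0 <= j < n.+1) A i j * (sign_vec R (2 ^ n + t) i * sign_vec R (2 ^ n + t) j)
    - \sum_(0 <= i < n.+1) A i i) ^+ 4) =
  \sum_(0 <= t < 2 ^ n) (2 * (q t ^+ 4) + 12 * (q t ^+ 2 * l t ^+ 2) + 2 * (l t ^+ 4)).
  by apply: eq_big_nat => t /= tn; have [-> ->] := qE _ tn; ring.
rewrite !big_split/= -!mulr_sumr.
have [_ l4] := linear_chaos n (fun i => A i n + A n i).
rewrite -/l in l4.
set Sl := \sum_(0 <= k < n) (A k n + A n k) ^+ 2 in l4.
have Sl0 : 0 <= Sl by apply: sumr_ge0 => *; exact: sqr_ge0.
have SlD : Sl <= 2 * D.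
  rewrite /Sl /D mulr_sumr; apply: ler_sum => i _.
  have := sqr_ge0 (A i n - A n i); lra.
have p0 : 0 < 2 ^+ n :> R by rewrite exprn_gt0.
have l4' : \sum_(0 <= t < 2 ^ n) l t ^+ 4 <= 2 ^+ n * (12 * D ^+ 2).
  apply: (le_trans l4); rewrite ler_pM2l//.
  have : Sl ^+ 2 <= (2 * D) ^+ 2 by rewrite ler_pXn2r ?nnegrE// mulr_ge0.
  lra.
(* Cauchy-Schwarz between the two fourth moments, with [36 ^+ 2 = 108 * 12]. *)
have ql : \sum_(0 <= t < 2 ^ n) q t ^+ 2 * l t ^+ 2 <= 2 ^+ n * (36 * (Nn * D)).
  have r0 : 0 <= 2 ^+ n * (36 * (Nn * D)) by rewrite !mulr_ge0// ltW.
  have q0 : 0 <= \sum_(0 <= t < 2 ^ n) q t ^+ 2 * l t ^+ 2.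
    by apply: sumr_ge0 => *; rewrite mulr_ge0 ?sqr_ge0.
  rewrite -ler_sqr ?nnegrE//.
  apply: le_trans (cauchy_schwarz_sum _ _ _) _.
  under eq_bigr do rewrite -exprM.
  under [X in _ * X]eq_bigr do rewrite -exprM.
  apply: (@le_trans _ _ ((2 ^+ n * (108 * Nn ^+ 2)) * (2 ^+ n * (12 * D ^+ 2)))).
    by apply: ler_pM => //; apply: sumr_ge0 => i _; rewrite exprn_even_ge0.
  by rewrite le_eqVlt; apply/orP; left; apply/eqP; ring.
(* The constant [108] is the one for which the mixed terms agree, [12 * 36 = 4 * 108]. *)
apply: (@le_trans _ _ (2 ^+ n.+1 * (108 * (Nn + D) ^+ 2))); last first.
  by rewrite ler_pM2l ?exprn_gt0// ler_pM2l// ler_pXn2r ?nnegrE ?addr_ge0// (le_trans _ NE)// addr_ge0.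
rewrite [2 ^+ n.+1]exprS.
have : 0 <= 2 ^+ n * D ^+ 2 by rewrite mulr_ge0 ?sqr_ge0// ltW.
lra.
Qed.

(** * Measurability of matrix functions *)

(** A copy of the matrix type, pointed by the zero matrix, on which [mx_borel] puts the
    sigma-algebra generated by [mx_gen]; random matrices then become measurable functions. *)
Definition mx_space (R : realType) (n : nat) : Type := 'M[R[i]]_n.
HB.instance Definition _ (R : realType) n := Choice.copy (mx_space R n) 'M[R[i]]_n.
HB.instance Definition _ (R : realType) n := isPointed.Build (mx_space R n) (0 : 'M[R[i]]_n).
Definition mx_borel (R : realType) (n : nat) : Type :=
  g_sigma_algebraType (@mx_gen R n : set (set (mx_space R n))).
HB.instance Definition _ (R : realType) n := Measurable.copy (mx_borel R n)
  (g_sigma_algebraType (@mx_gen R n : set (set (mx_space R n)))).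

(** Inversion is continuous off [0], and any function is measurable on a singleton. *)
Lemma measurable_inv_real (R : realType) :
  measurable_fun [set: R] (fun x : R => x^-1).
Proof.
have -> : [set: R] = [set 0] `|` ~` [set 0] by rewrite setUv.
apply/measurable_funU => //; first exact: measurableC.
split; first exact: measurable_fun_set1.
apply: open_continuous_measurable_fun.
  by rewrite openC; exact: closed_eq.
move=> x; rewrite inE /= => x0; apply: inv_continuous; exact/eqP.
Qed.

(** Measurability by real and imaginary parts, in accordance with the generators [mx_gen]. *)
Definition cmeas d (T : measurableType d) (R : realType) (f : T -> R[i]) : Prop :=
  measurable_fun [set: T] (fun t => complex.Re (f t)) /\
  measurable_fun [set: T] (fun t => complex.Im (f t)).

Section ComplexMeasurable.
Context d (T : measurableType d) (R : realType).
Implicit Types f g : T -> R[i].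

Lemma cmeas_eq f g : f =1 g -> cmeas f -> cmeas g.
Proof. by move=> /funext ->. Qed.

Lemma cmeas_cst (c : R[i]) : cmeas (fun _ : T => c).
Proof. by split; exact: measurable_cst. Qed.

Lemma cmeasD f g : cmeas f -> cmeas g -> cmeas (fun t => f t + g t).
Proof.
move=> [f1 f2] [g1 g2]; split.
  rewrite (_ : (fun t => _) = (fun t => complex.Re (f t)) \+ (fun t => complex.Re (g t))).
    exact: measurable_funD.
  by apply/funext => t /=; case: (f t) (g t) => [a b] [c e].
rewrite (_ : (fun t => _) = (fun t => complex.Im (f t)) \+ (fun t => complex.Im (g t))).
  exact: measurable_funD.
by apply/funext => t /=; case: (f t) (g t) => [a b] [c e].
Qed.

Lemma cmeasM f g : cmeas f -> cmeas g -> cmeas (fun t => f t * g t).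
Proof.
move=> [f1 f2] [g1 g2]; split.
  rewrite (_ : (fun t => _) = ((fun t => complex.Re (f t)) \* (fun t => complex.Re (g t))) \-
     ((fun t => complex.Im (f t)) \* (fun t => complex.Im (g t)))).
    by apply: measurable_funB; exact: measurable_funM.
  by apply/funext => t /=; case: (f t) (g t) => [a b] [c e].
rewrite (_ : (fun t => _) = ((fun t => complex.Re (f t)) \* (fun t => complex.Im (g t))) \+
     ((fun t => complex.Im (f t)) \* (fun t => complex.Re (g t)))).
  by apply: measurable_funD; exact: measurable_funM.
by apply/funext => t /=; case: (f t) (g t) => [a b] [c e].
Qed.

Lemma cmeasN f : cmeas f -> cmeas (fun t => - f t).
Proof.
move=> h; apply: (cmeas_eq (f := fun t => (-1) * f t)); first by move=> t; rewrite mulN1r.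
by apply: cmeasM => //; exact: cmeas_cst.
Qed.

Lemma cmeasV f : cmeas f -> cmeas (fun t => (f t)^-1).
Proof.
move=> [f1 f2].
have mN : measurable_fun [set: T] (fun t => (complex.Re (f t) ^+ 2 + complex.Im (f t) ^+ 2)^-1).
  rewrite (_ : (fun t => _) = (fun x : R => x^-1) \o
    ((fun t => complex.Re (f t) ^+ 2) \+ (fun t => complex.Im (f t) ^+ 2)))//.
  apply: measurableT_comp; first exact: measurable_inv_real.
  by apply: measurable_funD; exact: measurable_funX.
split.
  rewrite (_ : (fun t => _) = (fun t => complex.Re (f t)) \*
    (fun t => (complex.Re (f t) ^+ 2 + complex.Im (f t) ^+ 2)^-1)).
    exact: measurable_funM.
  by apply/funext => t /=; case: (f t) => a b.
rewrite (_ : (fun t => _) = (\- (fun t => complex.Im (f t))) \*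
    (fun t => (complex.Re (f t) ^+ 2 + complex.Im (f t) ^+ 2)^-1)).
  by apply: measurable_funM => //; exact: measurable_funN.
by apply/funext => t /=; case: (f t) => a b /=; rewrite mulNr.
Qed.

Lemma cmeas_sum I (s : seq I) (F : I -> T -> R[i]) :
  (forall i, cmeas (F i)) -> cmeas (fun t => \sum_(i <- s) F i t).
Proof.
move=> h; elim: s => [|i s IH].
  by apply: cmeas_eq (cmeas_cst 0) => t; rewrite big_nil.
by apply: cmeas_eq (cmeasD (h i) IH) => t; rewrite big_cons.
Qed.

Lemma cmeas_prod I (s : seq I) (F : I -> T -> R[i]) :
  (forall i, cmeas (F i)) -> cmeas (fun t => \prod_(i <- s) F i t).
Proof.
move=> h; elim: s => [|i s IH].
  by apply: cmeas_eq (cmeas_cst 1) => t; rewrite big_nil.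
by apply: cmeas_eq (cmeasM (h i) IH) => t; rewrite big_cons.
Qed.

Lemma cmeas_mulmx m n p (A : T -> 'M[R[i]]_(m, n)) (B : T -> 'M[R[i]]_(n, p)) i j :
  (forall i j, cmeas (fun t => A t i j)) -> (forall i j, cmeas (fun t => B t i j)) ->
  cmeas (fun t => (A t *m B t) i j).
Proof.
move=> hA hB; apply: (cmeas_eq (f := fun t => \sum_k A t i k * B t k j)).
  by move=> t; rewrite mxE.
by apply: cmeas_sum => k; exact: cmeasM.
Qed.

Lemma cmeas_det m (B : T -> 'M[R[i]]_m) :
  (forall i j, cmeas (fun t => B t i j)) -> cmeas (fun t => \det (B t)).
Proof.
move=> h; apply: cmeas_sum => s; apply: cmeasM; first exact: cmeas_cst.
by apply: cmeas_prod => i; exact: h.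
Qed.

Lemma cmeas_adj m (B : T -> 'M[R[i]]_m) i j :
  (forall i j, cmeas (fun t => B t i j)) -> cmeas (fun t => \adj (B t) i j).
Proof.
move=> h; apply: (cmeas_eq (f := fun t => (-1) ^+ (j + i) * \det (row' j (col' i (B t))))).
  by move=> t; rewrite mxE.
apply: cmeasM; first exact: cmeas_cst.
apply: cmeas_det => k l; apply: cmeas_eq (h (lift j k) (lift i l)) => t.
by rewrite !mxE.
Qed.

End ComplexMeasurable.

Lemma cmeas_entry (R : realType) n (i j : 'I_n) :
  cmeas (fun M : mx_borel R n => (M : 'M[R[i]]_n) i j).
Proof.
by split=> _ B mB; rewrite setTI; apply: sub_sigma_algebra; exists i, j, B; split => //; [left|right].
Qed.

(** * Fluctuations of the resolvent quadratic form *)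

(** The difference at [z] between the Stieltjes transforms of the spectral measure of [M] at [v] and
    of the empirical spectral measure. *)
Definition fluct (R : realType) n (z : R[i]) (v : 'cV[R[i]]_n) (M : 'M[R[i]]_n) : R[i] :=
  (adjmx v *m resolvent z M *m v) 0 0 - ((n%:R^-1)%:C)%C * \tr (resolvent z M).

(** Fourth powers of the two parts, rather than of the modulus, so that a real chaos inequality
    applies to each. *)
Definition fluct4 (R : realType) n (z : R[i]) (v : 'cV[R[i]]_n) (M : 'M[R[i]]_n) : R :=
  complex.Re (fluct z v M) ^+ 4 + complex.Im (fluct z v M) ^+ 4.

Lemma fluct4_ge0 (R : realType) n (z : R[i]) (v : 'cV[R[i]]_n) (M : 'M[R[i]]_n) :
  0 <= fluct4 z v M.
Proof. by rewrite addr_ge0// exprn_even_ge0. Qed.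

Lemma measurable_fluct4 (R : realType) n (z : R[i]) (v : 'cV[R[i]]_n) :
  measurable_fun [set: mx_borel R n] (fun M => fluct4 z v M).
Proof.
have mE i j : cmeas (fun M : mx_borel R n => (z%:M - (M : 'M[R[i]]_n)) i j).
  apply: (cmeas_eq (f := fun M : mx_borel R n => (z%:M : 'M[R[i]]_n) i j + - (M : 'M[R[i]]_n) i j)).
    by move=> M; rewrite !mxE.
  apply: cmeasD; first exact: cmeas_cst.
  by apply: cmeasN; exact: cmeas_entry.
have mR i j : cmeas (fun M : mx_borel R n => resolvent z (M : 'M[R[i]]_n) i j).
  apply: (cmeas_eq (f := fun M : mx_borel R n => (\det (z%:M - (M : 'M[R[i]]_n)))^-1 *
     \adj (z%:M - (M : 'M[R[i]]_n)) i j)); first by move=> M; rewrite [RHS]mxE.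
  by apply: cmeasM; [apply: cmeasV; exact: cmeas_det | exact: cmeas_adj].
have [m1 m2] : cmeas (fun M : mx_borel R n => fluct z v (M : 'M[R[i]]_n)).
  apply: cmeasD.
    apply: cmeas_mulmx => i j; last exact: cmeas_cst.
    by apply: cmeas_mulmx => k l //; exact: cmeas_cst.
  apply: cmeasN; apply: cmeasM; first exact: cmeas_cst.
  by apply: cmeas_sum => i.
by apply: measurable_funD; exact: measurable_funX.
Qed.

Lemma measurable_random_mx (R : realType) d (T : measurableType d) n (X : T -> 'M[R[i]]_n) :
  (forall i j, cmeas (fun w => X w i j)) -> random_mx X.
Proof.
move=> h.
have mX : measurable_fun [set: T] (X : T -> mx_borel R n).
  apply: (measurability (@mx_gen R n : set (set (mx_borel R n)))) => //.
  move=> _ [A [i [j [B [mB AE]]]] <-]; case: AE => ->.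
    by case: (h i j) => /(_ measurableT B mB) + _.
  by case: (h i j) => _ /(_ measurableT B mB).
by move=> A mA; rewrite -[X @^-1` A]setTI; exact: mX.
Qed.

Lemma random_mx_cmeas (R : realType) d (T : measurableType d) n (X : T -> 'M[R[i]]_n) i j :
  random_mx X -> cmeas (fun w => X w i j).
Proof.
move=> mX; split=> _ B mB; rewrite setTI.
  apply: (mX [set M | B (complex.Re (M i j))]); apply: sub_sigma_algebra.
  by exists i, j, B; split => //; left.
apply: (mX [set M | B (complex.Im (M i j))]); apply: sub_sigma_algebra.
by exists i, j, B; split => //; right.
Qed.

Lemma random_mx_measurable (R : realType) d (T : measurableType d) n (X : T -> 'M[R[i]]_n) :
  random_mx X -> measurable_fun [set: T] (X : T -> mx_borel R n).
Proof. by move=> mX _ A mA; rewrite setTI; exact: mX. Qed.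

Lemma random_mx_conj (R : realType) d (T : measurableType d) n (X : T -> 'M[R[i]]_n)
    (U V : 'M[R[i]]_n) :
  random_mx X -> random_mx (fun w => U *m X w *m V).
Proof.
move=> mX; apply: measurable_random_mx => i j.
apply: cmeas_mulmx => k l; last exact: cmeas_cst.
by apply: cmeas_mulmx => a b; [exact: cmeas_cst|exact: random_mx_cmeas].
Qed.

(** Both sides are integrals of [h] against the law of a random matrix, and invariance says that the
    two laws agree on [mx_measurable] sets. *)
Lemma conj_invariant_integral (R : realType) d (T : measurableType d) (P : probability T R)
    rc n (X : T -> 'M[R[i]]_n) (U : 'M[R[i]]_n) (h : 'M[R[i]]_n -> R) :
  random_mx X -> conj_invariant rc P X -> U \is unitarymx -> over_field rc U ->
  measurable_fun [set: mx_borel R n] (h : mx_borel R n -> R) -> (forall M, 0 <= h M) ->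
  (\int[P]_w (h (X w))%:E = \int[P]_w (h (U *m X w *m adjmx U))%:E)%E.
Proof.
move=> mX cX uU rU mh h0.
have mX1 := random_mx_measurable mX.
have mX2 := random_mx_measurable (random_mx_conj U (adjmx U) mX).
have mhE : measurable_fun [set: mx_borel R n] (EFin \o (h : mx_borel R n -> R)).
  exact/measurable_EFinP.
have h0E : {in [set: mx_borel R n], forall y, (0 <= (EFin \o h) y)%E}.
  by move=> y _; rewrite lee_fin.
have e1 := ge0_integral_pushforward mX1 P measurableT mhE h0E.
have e2 := ge0_integral_pushforward mX2 P measurableT mhE h0E.
rewrite !preimage_setT in e1 e2.
rewrite [LHS](_ : _ = \int[P]_x ((EFin \o h) \o X) x)%E// -e1.
rewrite [RHS](_ : _ = \int[P]_x ((EFin \o h) \o (fun w => U *m X w *m adjmx U)) x)%E// -e2.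
apply: eq_measure_integral => A mA _; exact: cX.
Qed.

Lemma sqnV (R : realType) (z : R[i]) : sqn z^-1 = (sqn z)^-1.
Proof.
have [->|z0] := eqVneq z 0; first by rewrite invr0 sqn_real expr0n /= invr0.
have sz : sqn z != 0 by rewrite sqn_eq0.
apply: (mulIf sz); rewrite mulVf// -sqnM mulVf//.
by rewrite sqn_real expr1n.
Qed.

(** Conjugation moves from the matrix to the vector; the phase [c] cancels in the quadratic form and
    the trace is unchanged. *)
Lemma fluct4_conj (R : realType) n (z c : R[i]) (v w : 'cV[R[i]]_n) (M U : 'M[R[i]]_n) :
  complex.Im z != 0 -> is_hermitian M -> U \is unitarymx -> sqn c = 1 ->
  adjmx U *m v = c *: w -> fluct4 z v (U *m M *m adjmx U) = fluct4 z w M.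
Proof.
move=> z0 hM uU c1 Uv; rewrite /fluct4.
suff -> : fluct z v (U *m M *m adjmx U) = fluct z w M by [].
rewrite /fluct resolvent_conj//; congr (_ - _ * _); last first.
  by have [_ U2] := unitarymx_adjP uU; rewrite mxtrace_mulC mulmxA U2 mul1mx.
have -> : adjmx v *m (U *m resolvent z M *m adjmx U) *m v =
    adjmx (adjmx U *m v) *m resolvent z M *m (adjmx U *m v).
  by rewrite adjmxM adjmxK !mulmxA.
rewrite Uv adjmxZ -!scalemxAl -scalemxAr scalerA conj_mul_self c1.
by rewrite scale1r.
Qed.

Definition unit_sign_vec (R : realType) n t : 'cV[R[i]]_n :=
  \col_k ((sign_vec R t k / Num.sqrt n%:R)%:C)%C.

Lemma unit_sign_vec_unit (R : realType) n t : (0 < n)%N ->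
  adjmx (unit_sign_vec R n t) *m unit_sign_vec R n t = 1%:M.
Proof.
move=> n0; rewrite adj_mul_self; congr (_%:M).
rewrite (eq_bigr (fun=> n%:R^-1 : R)); last first.
  move=> i _; rewrite mxE sqn_real exprMn sign_vec_sqr mul1r exprVn sqr_sqrtr//.
by rewrite sumr_const card_ord -[_ *+ _]mulr_natr mulVf// pnatr_eq0 -lt0n.
Qed.

Lemma unit_sign_vec_real (R : realType) n t rc : over_field rc (unit_sign_vec R n t).
Proof. by move=> _; apply/mxOverP => i j; rewrite mxE realc_real. Qed.

(** At a sign vector the trace is exactly the diagonal part of the quadratic form, which leaves a
    homogeneous chaos of degree two. *)
Lemma fluct_sign_vec (R : realType) n (z : R[i]) (M : 'M[R[i]]_n) t : (0 < n)%N ->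
  fluct z (unit_sign_vec R n t) M =
  ((n%:R^-1)%:C)%C * (\sum_(i < n) \sum_(j < n) resolvent z M i j *
     ((sign_vec R t i * sign_vec R t j)%:C)%C - \sum_(i < n) resolvent z M i i).
Proof.
move=> n0; rewrite /fluct mulrBr; congr (_ - _).
set A := resolvent z M.
rewrite exchange_big/= mulr_sumr mxE; apply: eq_bigr => j _.
rewrite mxE !mulr_suml mulr_sumr; apply: eq_bigr => i _.
rewrite adjmxE !mxE conjC_realc.
have -> : ((n%:R^-1)%:C)%C = (((Num.sqrt n%:R)^-1)%:C)%C * (((Num.sqrt n%:R)^-1)%:C)%C :> R[i].
  by rewrite -rmorphM -expr2 exprVn sqr_sqrtr.
rewrite !rmorphM /=; ring.
Qed.

Lemma Re_scale (R : realType) (x : R) (z : R[i]) :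
  complex.Re (((x%:C)%C : R[i]) * z) = x * complex.Re z.
Proof. by case: z => a b /=; rewrite mul0r subr0. Qed.

Lemma Im_scale (R : realType) (x : R) (z : R[i]) :
  complex.Im (((x%:C)%C : R[i]) * z) = x * complex.Im z.
Proof. by case: z => a b /=; rewrite mul0r addr0. Qed.

(** The squared Hilbert-Schmidt norm of the resolvent is at most [n%:R / complex.Im z ^+ 2]; its
    square, against the factor [n%:R^-1 ^+ 4] from normalization, gives the order [n^-2]. *)
Lemma fluct4_sign_average (R : realType) n (z : R[i]) (M : 'M[R[i]]_n) :
  (0 < n)%N -> complex.Im z != 0 -> is_hermitian M ->
  \sum_(0 <= t < 2 ^ n) fluct4 z (unit_sign_vec R n t) M <=
  2 ^+ n * (108 / (complex.Im z ^+ 4 * n%:R ^+ 2)).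
Proof.
move=> n0 z0 hM; have [W eW] := hermitian_eigenbasis hM.
set A := resolvent z M.
(* [f] stands for the real or the imaginary part: being real linear, it turns the fluctuation into a
   real chaos. *)
have chaos (f : R[i] -> R) : {morph f : x y / x + y} -> {morph f : x / - x} ->
    (forall (x : R) w, f ((x%:C)%C * w) = x * f w) ->
    \sum_(0 <= t < 2 ^ n) f (fluct z (unit_sign_vec R n t) M) ^+ 4 <=
    n%:R^-1 ^+ 4 * (2 ^+ n * (108 * (\sum_(i < n) \sum_(j < n) f (A i j) ^+ 2) ^+ 2)).
  move=> fD fN fZ; have f0 : f 0 = 0 by have := fZ 0 0; rewrite mulr0 mul0r.
  have fS (G : 'I_n -> R[i]) : f (\sum_(i < n) G i) = \sum_(i < n) f (G i).
    by apply: (big_morph f).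
  case: n n0 M hM W eW @A f0 fS => // n _ M hM W eW A f0 fS.
  pose B i j := f (A (inord i) (inord j)).
  have -> : \sum_(i < n.+1) \sum_(j < n.+1) f (A i j) ^+ 2 =
      \sum_(0 <= i < n.+1) \sum_(0 <= j < n.+1) B i j ^+ 2.
    rewrite big_mkord; apply: eq_bigr => i _; rewrite big_mkord; apply: eq_bigr => j _.
    by rewrite /B !inord_val.
  have -> : \sum_(0 <= t < 2 ^ n.+1) f (fluct z (unit_sign_vec R n.+1 t) M) ^+ 4 =
    n.+1%:R^-1 ^+ 4 * \sum_(0 <= t < 2 ^ n.+1) (\sum_(0 <= i < n.+1) \sum_(0 <= j < n.+1)
      B i j * (sign_vec R t i * sign_vec R t j) - \sum_(0 <= i < n.+1) B i i) ^+ 4.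
    rewrite mulr_sumr; apply: eq_bigr => t _; rewrite fluct_sign_vec// fZ exprMn; congr (_ * _ ^+ 4).
    rewrite fD fN !fS !big_mkord; congr (_ - _); last first.
      by apply: eq_bigr => i _; rewrite /B !inord_val.
    apply: eq_bigr => i _; rewrite fS big_mkord; apply: eq_bigr => j _.
    by rewrite [X in f X]mulrC fZ /B !inord_val mulrC.
  rewrite ler_pM2l; first exact: quadratic_chaos.
  by rewrite exprn_gt0// invr_gt0.
have cRe := chaos (@complex.Re R) _ _ (@Re_scale R).
have cIm := chaos (@complex.Im R) _ _ (@Im_scale R).
rewrite /fluct4 big_split/=.
apply: (le_trans (lerD (cRe _ _) (cIm _ _))).
1-4: by try move=> [? ?] [? ?]; try move=> [? ?].
set SR := \sum_(i < n) _; set SI := \sum_(i < n) _.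
have SR0 : 0 <= SR by apply: sumr_ge0 => i _; apply: sumr_ge0 => j _; exact: sqr_ge0.
have SI0 : 0 <= SI by apply: sumr_ge0 => i _; apply: sumr_ge0 => j _; exact: sqr_ge0.
have zp : 0 < complex.Im z ^+ 2 by rewrite exprn_even_gt0.
have np : 0 < n%:R :> R by rewrite ltr0n.
have S : SR + SI <= n%:R / complex.Im z ^+ 2.
  have -> : SR + SI = \sum_(i < n) sqn ((z - ((lam M i.+1)%:C)%C)^-1).
    rewrite -(resolvent_frobenius z0 eW) /SR /SI -big_split/=; apply: eq_bigr => i _.
    by rewrite -big_split.
  rewrite mulr_natl -[X in _ *+ X]card_ord -sumr_const; apply: ler_sum => i _.
  rewrite sqnV lef_pV2 ?posrE//.
    case: (z) z0 => a b /= b0; rewrite /sqn /= oppr0 addr0.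
    by rewrite lerDr sqr_ge0.
  by rewrite lt_neqAle sqn_ge0 andbT eq_sym sqn_eq0 nonreal_sub_neq0.
have S2 : SR ^+ 2 + SI ^+ 2 <= (n%:R / complex.Im z ^+ 2) ^+ 2.
  apply: (@le_trans _ _ ((SR + SI) ^+ 2)).
    have := mulr_ge0 SR0 SI0; lra.
  by rewrite ler_pXn2r// ?nnegrE ?addr_ge0// divr_ge0 ?ltW.
have -> : n%:R^-1 ^+ 4 * (2 ^+ n * (108 * SR ^+ 2)) + n%:R^-1 ^+ 4 * (2 ^+ n * (108 * SI ^+ 2)) =
  (n%:R^-1 ^+ 4 * 2 ^+ n * 108) * (SR ^+ 2 + SI ^+ 2) by ring.
have -> : 2 ^+ n * (108 / (complex.Im z ^+ 4 * n%:R ^+ 2)) =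
  (n%:R^-1 ^+ 4 * 2 ^+ n * 108) * (n%:R / complex.Im z ^+ 2) ^+ 2.
  by field; rewrite z0 gt_eqF.
by rewrite ler_pM2l// !mulr_gt0// ?exprn_gt0// invr_gt0.
Qed.

Lemma sume_const_nat (R : realType) N (x : \bar R) :
  (\sum_(0 <= t < N) x = (N%:R)%:E * x)%E.
Proof.
elim: N => [|N IH]; first by rewrite big_nil mul0e.
by rewrite big_nat_recr//= IH -natr1 EFinD ge0_muleDl ?lee_fin// mul1e.
Qed.

(** By invariance the expectation at [v] equals the one at each of the [2 ^ n] sign vectors, hence
    their average, which is bounded pointwise in the sample. *)
Lemma fluct4_expectation (R : realType) d (T : measurableType d) (P : probability T R)
    rc n (X : T -> 'M[R[i]]_n) (z : R[i]) (v : 'cV[R[i]]_n) :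
  (0 < n)%N -> complex.Im z != 0 ->
  random_mx X -> (forall w, is_hermitian (X w)) -> conj_invariant rc P X ->
  adjmx v *m v = 1%:M -> over_field rc v ->
  (\int[P]_w (fluct4 z v (X w))%:E <= (108 / (complex.Im z ^+ 4 * n%:R ^+ 2))%:E)%E.
Proof.
move=> n0 z0 mX hX cX v1 rv.
have inv t : (\int[P]_w (fluct4 z v (X w))%:E = \int[P]_w (fluct4 z (unit_sign_vec R n t) (X w))%:E)%E.
  have [U [c [uU rU c1 Uv]]] := unit_vectors_conjugate v1 (unit_sign_vec_unit R t n0) rv
     (@unit_sign_vec_real R n t rc).
  rewrite (conj_invariant_integral mX cX uU rU (measurable_fluct4 z v)); last exact: fluct4_ge0.
  by apply: eq_integral => w _; rewrite (fluct4_conj z0 (hX w) uU c1 Uv).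
have mF u : measurable_fun [set: T] (fun w => (fluct4 z u (X w))%:E).
  apply/measurable_EFinP.
  exact: (measurableT_comp (measurable_fluct4 z u) (random_mx_measurable mX)).
have sumE : (\sum_(0 <= t < 2 ^ n) \int[P]_w (fluct4 z (unit_sign_vec R n t) (X w))%:E =
   \int[P]_w (\sum_(0 <= t < 2 ^ n) fluct4 z (unit_sign_vec R n t) (X w))%:E)%E.
  rewrite -ge0_integral_sum//.
    by apply: eq_integral => w _; rewrite sumEFin.
  by move=> t w _; rewrite lee_fin fluct4_ge0.
have pn : (0 < (2 ^+ n : R)%:E)%E by rewrite lte_fin exprn_gt0.
rewrite -(@lee_pmul2l _ (2 ^+ n)%:E)//.
have -> : ((2 ^+ n)%:E * \int[P]_w (fluct4 z v (X w))%:E =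
  \sum_(0 <= t < 2 ^ n) \int[P]_w (fluct4 z (unit_sign_vec R n t) (X w))%:E)%E.
  under eq_bigr do rewrite -inv.
  by rewrite sume_const_nat natrX.
rewrite sumE.
apply: (@le_trans _ _ (\int[P]_w (cst ((2 ^+ n * (108 / (complex.Im z ^+ 4 * n%:R ^+ 2)))%:E)) w)%E).
  apply: ge0_le_integral => //.
  - by move=> w _; rewrite lee_fin; apply: sumr_ge0 => t _; exact: fluct4_ge0.
  - apply/measurable_EFinP; apply: measurable_sum => t.
    exact: (measurableT_comp (measurable_fluct4 z _) (random_mx_measurable mX)).
  - by move=> w _; rewrite lee_fin; exact: fluct4_sign_average.
rewrite integral_cst// [X in (_ * X)%E]probability_setT mule1.
by rewrite EFinM.
Qed.

(** * Almost sure convergence from summable moments *)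

Lemma inv_square_series_lt_pinfty (R : realType) (K : R) : 0 <= K ->
  (\sum_(0 <= n <oo) (K / n.+1%:R ^+ 2)%:E < +oo)%E.
Proof.
move=> K0; apply: (@le_lt_trans _ _ (2 * K)%:E); last exact: ltry.
have p n : (0 <= (K / n.+1%:R ^+ 2)%:E)%E by rewrite lee_fin divr_ge0// exprn_ge0.
apply: lime_le; first by apply: is_cvg_nneseries => n _ _.
apply: nearW => n.
suff h : \sum_(0 <= k < n) K / k.+1%:R ^+ 2 <= 2 * K * (1 - n.+1%:R^-1).
  rewrite sumEFin lee_fin (le_trans h)// -[leRHS]mulr1.
  by apply: ler_wpM2l; rewrite ?mulr_ge0// gerBl invr_ge0.
elim: n => [|n IH]; first by rewrite big_nil invr1 subrr mulr0.
rewrite big_nat_recr//= (le_trans (lerD IH (lexx _)))//.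
have -> : n.+2%:R = n.+1%:R + 1 :> R by rewrite natr1.
have : 1 <= n.+1%:R :> R by rewrite ler1n.
set x := n.+1%:R => x1.
have x0 : 0 < x by apply: lt_le_trans x1.
(* Comparison with a telescoping series, valid because [x] is at least [1]. *)
have key : (x ^+ 2)^-1 <= 2 * (x^-1 - (x + 1)^-1).
  have -> : 2 * (x^-1 - (x + 1)^-1) = (x ^+ 2)^-1 * (2 * x / (x + 1)).
    by field; rewrite !gt_eqF// addr_gt0.
  apply: ler_peMr; first by rewrite invr_ge0 exprn_ge0// ltW.
  by rewrite ler_pdivlMr ?addr_gt0//; lra.
have := ler_wpM2l K0 key; rewrite mulrCA mulrBr.
rewrite !(mulrBr (2 * K)) -!(mulrA 2); set A := K * (x ^+ 2)^-1; set B := K * x^-1; set C := K * (x + 1)^-1.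
lra.
Qed.

(** By monotone convergence the series of the [Y n.+1] has finite expectation, so it converges
    almost surely and its terms tend to zero. *)
Lemma summable_expectation_ae_cvg0 (R : realType) d (T : measurableType d)
    (P : probability T R) (Y : nat -> T -> R) (K : R) :
  0 <= K -> (forall n, measurable_fun [set: T] (Y n)) -> (forall n w, 0 <= Y n w) ->
  (forall n, (\int[P]_w (Y n.+1 w)%:E <= (K / n.+1%:R ^+ 2)%:E)%E) ->
  {ae P, forall w, (fun n => Y n w) @ \oo --> 0}.
Proof.
move=> K0 mY Y0 bY.
have mZ n : measurable_fun [set: T] (fun w => (Y n.+1 w)%:E) by exact/measurable_EFinP.
have Z0 n w : [set: T] w -> (0 <= (Y n.+1 w)%:E)%E by rewrite lee_fin.
have iZ := integral_nneseries P measurableT mZ Z0.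
have fin : (\int[P]_w (\sum_(0 <= n <oo) (Y n.+1 w)%:E) < +oo)%E.
  rewrite iZ; apply: le_lt_trans (inv_square_series_lt_pinfty K0).
  apply: lee_nneseries => [n _ _|n _]; last exact: bY.
  by apply: integral_ge0 => w _; rewrite lee_fin.
have int : P.-integrable [set: T] (fun w => \sum_(0 <= n <oo) (Y n.+1 w)%:E)%E.
  apply/integrableP; split.
    by apply: ge0_emeasurable_sum => // n w _ _; exact: Z0.
  rewrite (eq_integral (fun w => \sum_(0 <= n <oo) (Y n.+1 w)%:E)%E)// => w _.
  by rewrite gee0_abs//; apply: nneseries_ge0 => n _ _; exact: Z0.
have := integrable_ae measurableT int.
apply: filterS => w /(_ I) fw.
rewrite -cvg_shiftS; apply: cvg_series_cvg_0; apply: nnseries_is_cvg => //=.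
by rewrite -ge0_fin_numE//; apply: nneseries_ge0 => n _ _; exact: Z0.
Qed.

Lemma fluct4_cvg0 (R : realType) (a b : nat -> R) :
  (fun n => a n ^+ 4 + b n ^+ 4) @ \oo --> 0 -> a @ \oo --> 0.
Proof.
move=> /cvgr0Pnorm_lt h; apply/cvgr0Pnorm_lt => e e0.
have [N _ hN] := h _ (exprn_gt0 4 e0).
exists N => // n /hN /=; rewrite ger0_norm; last by rewrite addr_ge0// exprn_even_ge0.
move=> lt; rewrite -(@ltr_pXn2r _ 4)// ?nnegrE ?ltW//.
rewrite -normrX ger0_norm ?exprn_even_ge0//.
by apply: le_lt_trans lt; rewrite lerDl exprn_even_ge0.
Qed.

(** A countable grid in the upper half-plane, accumulating at every real point, so that a single
    almost sure event serves all its points. *)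
Definition spectral_point (R : realType) (q : rat) (k : nat) : R[i] :=
  (ratr q +i* k.+1%:R^-1)%C.

Lemma fluct_ae_cvg0 (R : realType) d (T : measurableType d) (P : probability T R) rc
    (X : forall n, T -> 'M[R[i]]_n) (v : forall n, 'cV[R[i]]_n) :
  (forall n, random_mx (X n)) -> (forall n w, is_hermitian (X n w)) ->
  (forall n, conj_invariant rc P (X n)) ->
  (forall n, (0 < n)%N -> adjmx (v n) *m v n = 1%:M /\ over_field rc (v n)) ->
  {ae P, forall w, forall q k,
    (fun n => complex.Re (fluct (spectral_point R q k) (v n) (X n w))) @ \oo --> 0 /\
    (fun n => complex.Im (fluct (spectral_point R q k) (v n) (X n w))) @ \oo --> 0}.
Proof.
move=> mX hX cX hv.
have one q k : {ae P, forall w,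
    (fun n => fluct4 (spectral_point R q k) (v n) (X n w)) @ \oo --> 0}.
  have z0 : complex.Im (spectral_point R q k) != 0 by rewrite /= invr_eq0 pnatr_eq0.
  apply: (@summable_expectation_ae_cvg0 _ _ _ _ _ (108 / (complex.Im (spectral_point R q k) ^+ 4))).
  - by rewrite divr_ge0// exprn_even_ge0.
  - move=> n; exact: (measurableT_comp (measurable_fluct4 _ _) (random_mx_measurable (mX n))).
  - by move=> *; exact: fluct4_ge0.
  - move=> n; have [v1 rv] := hv n.+1 isT.
    have := @fluct4_expectation _ _ _ P rc n.+1 (X n.+1) _ (v n.+1) isT z0 (mX _) (hX _) (cX _) v1 rv.
    by rewrite invfM mulrA.
(* The pairs [(q, k)] are enumerated through [unpickle], and a countable intersection is taken. *)
have all : {ae P, forall w m,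
    if unpickle m is Some (q, k) then
      (fun n => fluct4 (spectral_point R q k) (v n) (X n w)) @ \oo --> 0 else True}.
  apply: ae_foralln => m; case: (unpickle m : option (rat * nat)) => [[q k]|]; first exact: one.
  by apply: aeW.
apply: filterS all => w h q k.
have := h (pickle (q, k)); rewrite pickleK => hqk.
split; first exact: fluct4_cvg0 hqk.
by apply: (@fluct4_cvg0 _ _ (fun n => complex.Re (fluct (spectral_point R q k) (v n) (X n w))));
  under eq_fun do rewrite addrC.
Qed.

(** * Cauchy transforms *)

(** For [z = x + i eta], the imaginary part of [(z - t)^-1] is [- (eta * poisson_kernel x eta t)],
    and its real part is the conjugate kernel. Without the usual factor [eta], the kernel tends to
    [(x - t)^-2] off [t = x] as [eta] tends to zero. *)
Definition poisson_kernel (R : realType) (x eta t : R) : R := ((x - t) ^+ 2 + eta ^+ 2)^-1.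
Definition conj_poisson_kernel (R : realType) (x eta t : R) : R :=
  (x - t) * ((x - t) ^+ 2 + eta ^+ 2)^-1.

Section Kernels.
Context (R : realType) (x eta : R) (eta0 : 0 < eta).

Lemma kernel_denom_gt0 t : 0 < (x - t) ^+ 2 + eta ^+ 2.
Proof. by rewrite ltr_wpDl ?sqr_ge0// exprn_gt0. Qed.

Lemma kernel_denom_neq0 t : (x - t) ^+ 2 + eta ^+ 2 != 0.
Proof. by rewrite gt_eqF// kernel_denom_gt0. Qed.

Lemma poisson_kernel_ge0 t : 0 <= poisson_kernel x eta t.
Proof. by rewrite invr_ge0 ltW// kernel_denom_gt0. Qed.

Lemma continuous_poisson_kernel : continuous (poisson_kernel x eta).
Proof.
move=> t; apply: (@cvgV _ _ _ _ (fun t => (x - t) ^+ 2 + eta ^+ 2)).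
  exact: kernel_denom_neq0.
apply: cvgD; last exact: cvg_cst.
by apply: cvgM; apply: cvgB => //; exact: cvg_cst.
Qed.

Lemma continuous_conj_poisson_kernel : continuous (conj_poisson_kernel x eta).
Proof.
move=> t; apply: cvgM; last exact: continuous_poisson_kernel.
by apply: cvgB => //; exact: cvg_cst.
Qed.

Lemma poisson_kernel_bounded : exists M, forall t, `|poisson_kernel x eta t| <= M.
Proof.
exists (eta ^+ 2)^-1 => t; rewrite ger0_norm ?poisson_kernel_ge0//.
by rewrite lef_pV2 ?posrE ?kernel_denom_gt0 ?exprn_gt0// lerDr sqr_ge0.
Qed.

Lemma conj_poisson_kernel_bounded : exists M, forall t, `|conj_poisson_kernel x eta t| <= M.
Proof.
exists eta^-1 => t; rewrite normrM [X in _ * X]ger0_norm ?poisson_kernel_ge0//.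
rewrite ler_pdivrMr ?kernel_denom_gt0// mulrC ler_pdivlMr//.
rewrite -[(x - t) ^+ 2]real_normK ?num_real//.
have := sqr_ge0 (`|x - t| - eta); have := sqr_ge0 `|x - t|; have := sqr_ge0 eta; lra.
Qed.

(** The difference is [eta ^+ 2 / ((x - t) * ((x - t) ^+ 2 + eta ^+ 2))]. *)
Lemma conj_poisson_kernel_approx t delta : 0 < delta -> delta <= `|x - t| ->
  `|(x - t)^-1 - conj_poisson_kernel x eta t| <= eta ^+ 2 / delta ^+ 3.
Proof.
move=> d0 dx; have xt : x - t != 0 by rewrite -normr_gt0 (lt_le_trans d0).
have -> : (x - t)^-1 - conj_poisson_kernel x eta t =
    eta ^+ 2 / ((x - t) * ((x - t) ^+ 2 + eta ^+ 2)).
  by rewrite /conj_poisson_kernel; field; rewrite kernel_denom_neq0 xt.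
rewrite normrM [X in X * _]ger0_norm ?sqr_ge0//.
rewrite ler_wpM2l ?sqr_ge0// normfV lef_pV2 ?posrE ?exprn_gt0//; last first.
  by rewrite normr_gt0 mulf_neq0// kernel_denom_neq0.
rewrite normrM [delta ^+ 3]exprS; apply: ler_pM; rewrite ?sqr_ge0 ?(ltW d0)//.
rewrite ger0_norm ?(ltW (kernel_denom_gt0 _))// ler_wpDr ?sqr_ge0//.
by rewrite -[(x - t) ^+ 2]real_normK ?num_real// ler_pXn2r// nnegrE ltW.
Qed.

(** A Harnack inequality: [(y - t) ^+ 2] is at most [2 * (y - x) ^+ 2 + 2 * (x - t) ^+ 2]. It serves
    to pass between real and rational abscissae. *)
Lemma poisson_kernel_compare y t : `|y - x| <= eta ->
  poisson_kernel x eta t <= 3 * poisson_kernel y eta t.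
Proof.
move=> yx; rewrite /poisson_kernel ler_pdivlMr; last first.
  by rewrite ltr_wpDl ?sqr_ge0// exprn_gt0.
rewrite mulrC ler_pdivrMr ?kernel_denom_gt0//.
have : `|y - x| ^+ 2 <= eta ^+ 2 by rewrite ler_pXn2r// nnegrE ltW.
rewrite real_normK ?num_real//.
have := sqr_ge0 ((y - x) - (x - t)); have := sqr_ge0 (x - t); nra.
Qed.

End Kernels.

(** * Cauchy transform of a measure carried by a bounded set, and its derivative *)

Section CarriedMeasure.
Context (R : realType) (mu : probability R R) (S : set R) (lo hi : R).
Hypothesis mS : measurable S.
Hypothesis muS : mu (~` S) = 0%E.
Hypothesis bS : forall t, S t -> lo <= t <= hi.
Implicit Types (f g : R -> R) (x y z : R).

Lemma carried_mass : mu S = 1%E.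
Proof.
have := probability_setC mu (measurableC mS); rewrite setCK muS sube0.
by [].
Qed.

Lemma carried_nonempty : S !=set0.
Proof.
apply/set0P/eqP => S0; have := carried_mass; rewrite S0 measure0 => /esym/eqP.
by rewrite onee_eq0.
Qed.

Lemma carried_integral f : measurable_fun [set: R] f ->
  Rintegral mu [set: R] f = Rintegral mu S f.
Proof.
move=> mf; rewrite [RHS]Rintegral_mkcond /Rintegral; congr fine.
apply: ae_eq_integral => //.
- exact/measurable_EFinP.
- apply/measurable_EFinP; apply/(measurable_restrictT _ mS).
  exact: measurable_funS mf.
- exists (~` S); split => //; first exact: measurableC.
  move=> t /= h St; apply: h => _.
  by rewrite patchE mem_set.
Qed.

Lemma carried_integrable f M : measurable_fun [set: R] f ->
  (forall t, S t -> `|f t| <= M) -> mu.-integrable S (EFin \o f).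
Proof.
move=> mf fM; apply: measurable_bounded_integrable => //.
- by rewrite [X in (X < _)%E]carried_mass ltry.
- exact: measurable_funS mf.
- by exists M; split; rewrite ?num_real// => N MN t /= /fM /le_trans; apply; exact: ltW.
Qed.

Lemma carried_integral_cst c : Rintegral mu S (fun=> c) = c.
Proof. by rewrite Rintegral_cst// [X in fine X]carried_mass /= mulr1. Qed.

Lemma carried_le_cst f c : mu.-integrable S (EFin \o f) -> (forall t, S t -> f t <= c) ->
  Rintegral mu S f <= c.
Proof.
move=> intf fc; rewrite -[leRHS]carried_integral_cst; apply: le_Rintegral => //.
by apply: (@carried_integrable _ `|c|); first exact: measurable_cst.
Qed.

Lemma carried_ge_cst f c : mu.-integrable S (EFin \o f) -> (forall t, S t -> c <= f t) ->
  c <= Rintegral mu S f.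
Proof.
move=> intf fc; rewrite -[leLHS]carried_integral_cst; apply: le_Rintegral => //.
by apply: (@carried_integrable _ `|c|); first exact: measurable_cst.
Qed.

Lemma measurable_resolvent_fun z : measurable_fun [set: R] (fun t => (z - t)^-1).
Proof.
rewrite (_ : (fun t => _) = (fun x : R => x^-1) \o (cst z \- id))//.
apply: measurableT_comp; first exact: measurable_inv_real.
by apply: measurable_funB => //; exact: measurable_cst.
Qed.

Lemma resolvent_fun_bound z delta : 0 < delta -> (forall t, S t -> delta <= `|z - t|) ->
  forall t, S t -> `|(z - t)^-1| <= delta^-1.
Proof.
move=> d0 h t /h dt; rewrite normfV lef_pV2 ?posrE//; exact: lt_le_trans dt.
Qed.

Lemma resolvent_fun_integrable z delta : 0 < delta -> (forall t, S t -> delta <= `|z - t|) ->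
  mu.-integrable S (EFin \o (fun t => (z - t)^-1)).
Proof.
move=> d0 h; apply: carried_integrable (resolvent_fun_bound d0 h).
exact: measurable_resolvent_fun.
Qed.

Lemma cauchyG_carried z : cauchyG mu z = Rintegral mu S (fun t => (z - t)^-1).
Proof. by rewrite /cauchyG carried_integral//; exact: measurable_resolvent_fun. Qed.

(** The integrands differ by [(y - x) / ((x - t) * (y - t))], positive because no point of [S]
    separates [x] from [y]. *)
Lemma cauchyG_decr x y : x < y ->
  (forall t, S t -> 0 < (x - t) * (y - t)) ->
  (exists2 delta, 0 < delta & forall t, S t -> delta <= `|x - t|) ->
  (exists2 delta, 0 < delta & forall t, S t -> delta <= `|y - t|) ->
  cauchyG mu y < cauchyG mu x.
Proof.
move=> xy sgn [dx dx0 hx] [dy dy0 hy].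
have ix := resolvent_fun_integrable dx0 hx; have iy := resolvent_fun_integrable dy0 hy.
rewrite -subr_gt0 !cauchyG_carried -RintegralB//.
(* Boundedness of [S] keeps the difference above [(y - x) / D ^+ 2], whence the strict
   inequality. *)
set D := `|x| + `|y| + `|lo| + `|hi|.
have bD t : S t -> `|x - t| <= D /\ `|y - t| <= D.
  move=> /bS/andP[lt th].
  have : `|t| <= `|lo| + `|hi|.
    rewrite ler_norml; have := ler_norm hi; have := ler_norm (- lo); rewrite normrN.
    by have := normr_ge0 lo; have := normr_ge0 hi; lra.
  have := ler_normB x t; have := ler_normB y t.
  by rewrite /D; have := normr_ge0 x; have := normr_ge0 y; lra.
have [t0 St0] := carried_nonempty.
have D0 : 0 < D by have [h _] := bD _ St0; apply: lt_le_trans h; exact: lt_le_trans (hx _ St0).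
apply: (@lt_le_trans _ _ ((y - x) / D ^+ 2)).
  by rewrite divr_gt0 ?subr_gt0// exprn_gt0.
apply: carried_ge_cst.
  apply: (@carried_integrable _ (dx^-1 + dy^-1)).
    by apply: measurable_funB; exact: measurable_resolvent_fun.
  move=> t St; rewrite (le_trans (ler_normB _ _))// lerD//.
    exact: resolvent_fun_bound dx0 hx t St.
  exact: resolvent_fun_bound dy0 hy t St.
move=> t St; have p := sgn _ St; have [hx1 hy1] := bD _ St.
have x0 : x - t != 0 by apply: contraTneq p => ->; rewrite mul0r ltxx.
have y0 : y - t != 0 by apply: contraTneq p => ->; rewrite mulr0 ltxx.
have -> : (x - t)^-1 - (y - t)^-1 = (y - x) / ((x - t) * (y - t)).
  by field; rewrite x0 y0.
rewrite ler_wpM2l ?subr_ge0 ?(ltW xy)// lef_pV2 ?posrE ?exprn_gt0//.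
by rewrite -[leLHS]ger0_norm ?(ltW p)// normrM expr2 ler_pM.
Qed.

Lemma cauchyG_approx z eta delta : 0 < eta -> 0 < delta -> (forall t, S t -> delta <= `|z - t|) ->
  `|cauchyG mu z - Rintegral mu [set: R] (conj_poisson_kernel z eta)| <= eta ^+ 2 / delta ^+ 3.
Proof.
move=> e0 d0 h.
have mk : measurable_fun [set: R] (conj_poisson_kernel z eta).
  by apply: continuous_measurable_fun; exact: continuous_conj_poisson_kernel.
have [M kM] := conj_poisson_kernel_bounded z e0.
have ik : mu.-integrable S (EFin \o conj_poisson_kernel z eta).
  exact: carried_integrable mk (fun t _ => kM t).
have iz := resolvent_fun_integrable d0 h.
rewrite carried_integral// cauchyG_carried -RintegralB//.
have mB : measurable_fun [set: R] (fun t => (z - t)^-1 - conj_poisson_kernel z eta t).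
  by apply: measurable_funB => //; exact: measurable_resolvent_fun.
have bB t : S t -> `|(z - t)^-1 - conj_poisson_kernel z eta t| <= eta ^+ 2 / delta ^+ 3.
  by move=> St; apply: conj_poisson_kernel_approx => //; exact: h.
have iB := carried_integrable mB bB.
apply: (le_trans (le_normr_Rintegral mS iB)).
apply: carried_le_cst => //.
apply: (@carried_integrable _ (eta ^+ 2 / delta ^+ 3)).
  exact: measurableT_comp.
by move=> t St; rewrite normr_id bB.
Qed.

Lemma sq_resolvent_fun_integrable z delta : 0 < delta -> (forall t, S t -> delta <= `|z - t|) ->
  mu.-integrable S (EFin \o (fun t => (z - t)^-1 ^+ 2)).
Proof.
move=> d0 h; apply: (@carried_integrable _ (delta^-1 ^+ 2)).
  by apply: measurable_funX; exact: measurable_resolvent_fun.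
move=> t St; rewrite normrX ler_pXn2r ?nnegrE ?invr_ge0 ?(ltW d0)//.
exact: resolvent_fun_bound d0 h t St.
Qed.

(** Differentiation under the integral by a uniform estimate: the error of the difference quotient
    is [k * ((z - t)^-1 ^+ 2 * (k + z - t)^-1)]. *)
Lemma derive1_cauchyG z delta : 0 < delta -> (forall t, S t -> delta <= `|z - t|) ->
  derive1 (cauchyG mu) z = - Rintegral mu S (fun t => (z - t)^-1 ^+ 2).
Proof.
move=> d0 h; rewrite /derive1; apply: cvg_lim => //.
set I := Rintegral mu S _.
have i2 := sq_resolvent_fun_integrable d0 h.
have iz := resolvent_fun_integrable d0 h.
apply/cvgrPdist_le => e e0.
have c0 : 0 < 2 / delta ^+ 3 by rewrite divr_gt0// exprn_gt0.
(* The first bound keeps [k + z] at distance [delta / 2] from [S], the second makes the error at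
   most [e]. *)
have m0 : 0 < Num.min (delta / 2) (e / (2 / delta ^+ 3)).
  by rewrite lt_min !divr_gt0 ?exprn_gt0.
near=> k.
have k0 : k != 0 by near: k; exact: nbhs_dnbhs_neq.
have kd : `|k| < Num.min (delta / 2) (e / (2 / delta ^+ 3)).
  by near: k; apply: dnbhs0_lt.
move: kd; rewrite lt_min => /andP[kd ke].
have hk t : S t -> delta / 2 <= `|k + z - t|.
  move=> /h; have := ler_normB (k + z - t) k.
  have -> : k + z - t - k = z - t by ring.
  by lra.
have d20 : 0 < delta / 2 by rewrite divr_gt0.
have ik := resolvent_fun_integrable d20 hk.
have iB := RintegralB mS ik iz.
have mB : measurable_fun [set: R] (fun t => (k + z - t)^-1 - (z - t)^-1).
  by apply: measurable_funB; exact: measurable_resolvent_fun.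
have iB' : mu.-integrable S (EFin \o (fun t => (k + z - t)^-1 - (z - t)^-1)).
  apply: (@carried_integrable _ ((delta/2)^-1 + delta^-1)) => // t St.
  rewrite (le_trans (ler_normB _ _))// lerD//.
    exact: resolvent_fun_bound d20 hk t St.
  exact: resolvent_fun_bound d0 h t St.
rewrite /= -opprD normrN !cauchyG_carried -iB.
have -> : k^-1 *: Rintegral mu S (fun t => (k + z - t)^-1 - (z - t)^-1) =
    Rintegral mu S (fun t => k^-1 * ((k + z - t)^-1 - (z - t)^-1)).
  by rewrite RintegralZl.
have mC : measurable_fun [set: R] (fun t => k^-1 * ((k + z - t)^-1 - (z - t)^-1)).
  by apply: measurable_funM => //; exact: measurable_cst.
have key t : S t -> `|(z - t)^-1 ^+ 2 + k^-1 * ((k + z - t)^-1 - (z - t)^-1)| <= e.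
  move=> St; have zt : z - t != 0 by rewrite -normr_gt0 (lt_le_trans d0 (h _ St)).
  have kt : k + z - t != 0 by rewrite -normr_gt0 (lt_le_trans d20 (hk _ St)).
  have -> : (z - t)^-1 ^+ 2 + k^-1 * ((k + z - t)^-1 - (z - t)^-1) =
     k * ((z - t)^-1 ^+ 2 * (k + z - t)^-1) by field; rewrite k0 zt kt.
  rewrite normrM.
  have b3 : `|(z - t)^-1 ^+ 2 * (k + z - t)^-1| <= 2 / delta ^+ 3.
    have -> : 2 / delta ^+ 3 = delta^-1 ^+ 2 * (delta / 2)^-1.
      by field; rewrite gt_eqF.
    rewrite normrM normrX ler_pM ?exprn_ge0//.
      rewrite ler_pXn2r ?nnegrE ?invr_ge0 ?(ltW d0)//.
      exact: resolvent_fun_bound d0 h t St.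
    exact: resolvent_fun_bound d20 hk t St.
  rewrite (le_trans (ler_wpM2l (normr_ge0 _) b3))//.
  by rewrite -ler_pdivlMr// ltW.
have m2 : measurable_fun [set: R] (fun t => (z - t)^-1 ^+ 2).
  by apply: measurable_funX; exact: measurable_resolvent_fun.
have iC : mu.-integrable S (EFin \o (fun t => k^-1 * ((k + z - t)^-1 - (z - t)^-1))).
  exact: (integrableZl mS k^-1 iB').
rewrite -RintegralD//.
have mD : measurable_fun [set: R]
    (fun t => (z - t)^-1 ^+ 2 + k^-1 * ((k + z - t)^-1 - (z - t)^-1)) by exact: measurable_funD.
have iD := carried_integrable mD key.
apply: (le_trans (le_normr_Rintegral mS iD)).
apply: carried_le_cst => //; apply: (@carried_integrable _ e); first exact: measurableT_comp.
by move=> t St; rewrite normr_id key.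
Unshelve. all: by end_near.
Qed.

(** For [eta] at most the distance from [z] to [rho], itself at most that from [z] to [t], one has
    [(rho - t) ^+ 2 + eta ^+ 2 <= (4 + 1) * (z - t) ^+ 2]. *)
Lemma derive1_cauchyG_ge rho K :
  (forall k, Rintegral mu [set: R] (poisson_kernel rho k.+1%:R^-1) <= K) ->
  forall z, z != rho -> (forall t, S t -> `|z - rho| <= `|z - t|) ->
  - (5 * K) <= derive1 (cauchyG mu) z.
Proof.
move=> bK z zr h.
have h0 : 0 < `|z - rho| by rewrite normr_gt0 subr_eq0.
rewrite (derive1_cauchyG h0 h) lerN2.
have [k hk] : exists k, k.+1%:R^-1 <= `|z - rho|.
  exists (Num.truncn `|z - rho|^-1).
  rewrite -[leRHS]invrK lef_pV2 ?posrE ?invr_gt0// ltW//.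
  by apply: truncnS_gt.
apply: (le_trans _ (ler_wpM2l (ltW (ltr0n R 5)) (bK k))).
set eta := k.+1%:R^-1 in hk *.
have e0 : 0 < eta by rewrite invr_gt0.
have mk : measurable_fun [set: R] (poisson_kernel rho eta).
  by apply: continuous_measurable_fun; exact: continuous_poisson_kernel.
have [M kM] := poisson_kernel_bounded rho e0.
have ik : mu.-integrable S (EFin \o poisson_kernel rho eta).
  exact: carried_integrable mk (fun t _ => kM t).
rewrite carried_integral// -RintegralZl//.
apply: le_Rintegral => //.
- exact: sq_resolvent_fun_integrable h0 h.
- exact: (integrableZl mS 5 ik).
move=> t St; have ht := h _ St.
have zt : 0 < `|z - t| by exact: lt_le_trans ht.
rewrite exprVn /poisson_kernel ler_pdivlMr ?kernel_denom_gt0// mulrC ler_pdivrMr; last first.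
  by rewrite -[(z - t) ^+ 2]real_normK ?num_real// exprn_gt0.
have e2 : eta ^+ 2 <= (z - rho) ^+ 2.
  by rewrite -[leRHS]real_normK ?num_real// ler_pXn2r ?nnegrE// ltW.
have t2 : (z - rho) ^+ 2 <= (z - t) ^+ 2.
  by rewrite -[leRHS]real_normK ?num_real// -[leLHS]real_normK ?num_real// ler_pXn2r ?nnegrE.
have := sqr_ge0 ((z - t) + (z - rho)); lra.
Qed.

(** Bounded Poisson integrals would bound the derivative from below near [rho]. The filter [F]
    stands for either one-sided approach to [rho]. *)
Lemma poisson_unbounded (F : set_system R) (FF : ProperFilter F) rho :
  (derive1 (cauchyG mu) z)%:E @[z --> F] --> -oo%E ->
  (\forall z \near F, z != rho /\ forall t, S t -> `|z - rho| <= `|z - t|) ->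
  forall K, exists k, K < Rintegral mu [set: R] (poisson_kernel rho k.+1%:R^-1).
Proof.
move=> /cvgeNyPle dF nF K; apply: contrapT => /forallNP hK.
have bK k : Rintegral mu [set: R] (poisson_kernel rho k.+1%:R^-1) <= K.
  by rewrite leNgt; apply/negP/hK.
have [z [[zr hz]]] := filter_ex (filterI nF (dF (- (5 * K) - 1))).
rewrite lee_fin => le; have := derive1_cauchyG_ge bK zr hz; lra.
Qed.
End CarriedMeasure.

(** * Perturbed eigenvectors *)

Section RankOnePerturbation.
Context (R : realType) (n : nat) (X W : 'M[R[i]]_n) (u v : 'cV[R[i]]_n) (theta zeta : R).
Hypothesis eW : eigenbasis X W.
Hypothesis v1 : adjmx v *m v = 1%:M.

(** The mass contributed by eigenvector [i] to the spectral measure of [X] at [v]. *)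
Definition spectral_weight (i : 'I_n) : R := sqn ((W *m v) i 0).

Lemma spectral_weight_sum : \sum_(i < n) spectral_weight i = 1.
Proof.
have [_ W2 _] := eW; apply: complexI; rewrite -(parseval_sqn _ W2) v1 mxE eqxx.
by [].
Qed.

Hypothesis u1 : vnorm u = 1.
Hypothesis uE : (X + (theta%:C)%C *: (v *m adjmx v)) *m u = (zeta%:C)%C *: u.

Lemma eigvec_weight_sum : \sum_(i < n) sqn ((W *m u) i 0) = 1.
Proof.
have [_ W2 _] := eW; apply: complexI; rewrite -(parseval_sqn _ W2) adj_mul_self mxE eqxx mulr1n.
congr (_%:C)%C; have e : \sum_(i < n) sqn (u i 0) = \sum_(i < n) complex.Re (u i 0 * Num.conj (u i 0)).
  by apply: eq_bigr => i _; rewrite mulrC conj_mul_self.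
have := u1; rewrite /vnorm -e => /(congr1 (fun x => x ^+ 2)).
rewrite sqr_sqrtr ?expr1n// sumr_ge0// => i _; exact: sqn_ge0.
Qed.

(** Each term equals [(zeta - lambda_i) ^+ 2 / ((zeta - lambda_i) ^+ 2 + eta ^+ 2)] times the
    squared modulus of coordinate [i] of [u], and these squared moduli sum to one. *)
Lemma eigvec_poisson_bound eta : 0 < eta ->
  theta ^+ 2 * sqn ((adjmx v *m u) 0 0) *
    \sum_(i < n) spectral_weight i * poisson_kernel zeta eta (lam X i.+1) <= 1.
Proof.
move=> e0; rewrite -eigvec_weight_sum mulr_sumr; apply: ler_sum => i _.
rewrite /spectral_weight /poisson_kernel mulrA ler_pdivrMr ?kernel_denom_gt0//.
have := congr1 (@sqn R) (eigvec_coords eW uE i).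
rewrite !sqnM !sqn_real => <-.
by rewrite mulrC ler_wpM2l ?sqn_ge0// lerDl sqr_ge0.
Qed.

(** The coordinates of [u], solved from the eigenvalue equation, are inserted into the inner product
    [c] of [v] and [u], and [c] is cancelled. *)
Lemma secular_equation : sqn ((adjmx v *m u) 0 0) != 0 ->
  (forall i : 'I_n, zeta != lam X i.+1) ->
  theta * \sum_(i < n) spectral_weight i * (zeta - lam X i.+1)^-1 = 1.
Proof.
rewrite sqn_eq0 => c0 zl; set c := (adjmx v *m u) 0 0 in c0 *.
have [_ W2 _] := eW.
have cE : c = \sum_(i < n) Num.conj ((W *m v) i 0) * (W *m u) i 0 by exact: parseval.
apply: complexI; apply: (mulIf c0).
rewrite -[X in _ * c = X]/(1 * c) mul1r [RHS]cE rmorphM /= real_complex_sum mulr_sumr mulr_suml.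
apply: eq_bigr => i _.
have z0 : ((zeta - lam X i.+1)%:C)%C != 0 :> R[i].
  by rewrite (inj_eq (@complexI R) _ 0) subr_eq0.
apply: (mulIf z0); have ec := eigvec_coords eW uE i.
rewrite -[RHS]mulrA [(W *m u) i 0 * _]mulrC ec rmorphM /= /spectral_weight -conj_mul_self fmorphV /=.
rewrite -/c; move: z0; set zz := ((zeta - _)%:C)%C => z0.
by field; rewrite -rmorphB.
Qed.
End RankOnePerturbation.

Lemma ReD (R : realType) (z w : R[i]) : complex.Re (z + w) = complex.Re z + complex.Re w.
Proof. by case: z w => [? ?] [? ?]. Qed.

Lemma ReB (R : realType) (z w : R[i]) : complex.Re (z - w) = complex.Re z - complex.Re w.
Proof. by case: z w => [? ?] [? ?]. Qed.

Lemma ImB (R : realType) (z w : R[i]) : complex.Im (z - w) = complex.Im z - complex.Im w.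
Proof. by case: z w => [? ?] [? ?]. Qed.

Lemma Re_sum (R : realType) (I : Type) (s : seq I) (F : I -> R[i]) :
  complex.Re (\sum_(i <- s) F i) = \sum_(i <- s) complex.Re (F i).
Proof. by apply: (big_morph (@complex.Re R)) => // [[? ?] [? ?]]. Qed.

Lemma Im_sum (R : realType) (I : Type) (s : seq I) (F : I -> R[i]) :
  complex.Im (\sum_(i <- s) F i) = \sum_(i <- s) complex.Im (F i).
Proof. by apply: (big_morph (@complex.Im R)) => // [[? ?] [? ?]]. Qed.

Lemma Re_resolvent_fun (R : realType) (x eta l : R) :
  complex.Re (((x +i* eta)%C - (l%:C)%C)^-1) = conj_poisson_kernel x eta l.
Proof. by rewrite /conj_poisson_kernel /= oppr0 addr0. Qed.

Lemma Im_resolvent_fun (R : realType) (x eta l : R) :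
  complex.Im (((x +i* eta)%C - (l%:C)%C)^-1) = - (eta * poisson_kernel x eta l).
Proof. by rewrite /poisson_kernel /= oppr0 addr0 -?mulNr. Qed.

Lemma Re_fluct (R : realType) n (X W : 'M[R[i]]_n) (v : 'cV[R[i]]_n) (x eta : R) :
  eta != 0 -> eigenbasis X W ->
  complex.Re (fluct (x +i* eta)%C v X) =
    \sum_(i < n) spectral_weight W v i * conj_poisson_kernel x eta (lam X i.+1)
    - emp_integral X (conj_poisson_kernel x eta).
Proof.
move=> e0 eW; rewrite /fluct (resolvent_quad v _ eW)// (resolvent_trace _ eW)//.
rewrite ReB Re_scale /emp_integral !Re_sum; congr (_ - _ * _).
  by apply: eq_bigr => i _; rewrite Re_scale Re_resolvent_fun.
by apply: eq_bigr => i _; rewrite Re_resolvent_fun.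
Qed.

Lemma Im_fluct (R : realType) n (X W : 'M[R[i]]_n) (v : 'cV[R[i]]_n) (x eta : R) :
  eta != 0 -> eigenbasis X W ->
  complex.Im (fluct (x +i* eta)%C v X) =
    - eta * (\sum_(i < n) spectral_weight W v i * poisson_kernel x eta (lam X i.+1)
    - emp_integral X (poisson_kernel x eta)).
Proof.
move=> e0 eW; rewrite /fluct (resolvent_quad v _ eW)// (resolvent_trace _ eW)//.
rewrite ImB Im_scale /emp_integral !Im_sum mulrBr; congr (_ - _).
  rewrite mulr_sumr; apply: eq_bigr => i _; rewrite Im_scale Im_resolvent_fun.
  by rewrite mulrN mulrCA mulNr.
rewrite mulrCA; congr (_ * _); rewrite mulr_sumr; apply: eq_bigr => i _.
by rewrite Im_resolvent_fun mulNr.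
Qed.

Lemma dist_triangle_half (R : realType) (e z p x : R) :
  `|z - p| <= e / 2 -> p < x -> x < p + e / 2 -> `|z - x| <= e.
Proof.
rewrite !ler_norml => /andP[z1 z2] px xp; apply/andP; split; lra.
Qed.

(** * Deterministic asymptotics of weighted spectral measures and of the overlap [c n] *)

Section SpectralMeasureSequence.
Context (R : realType) (mu : probability R R) (S : set R).
Hypothesis mS : measurable S.
Hypothesis muS : mu (~` S) = 0%E.
(* Weights and atoms of the spectral measures of [X_n] at the perturbation vector. *)
Context (q l : nat -> nat -> R) (zeta c : nat -> R) (theta : R).
Hypothesis theta0 : 0 < theta.
Hypothesis q0 : forall n i, 0 <= q n i.
Hypothesis q1 : forall n, (0 < n)%N -> \sum_(i < n) q n i = 1.
Hypothesis cvg_poisson : forall r k,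
  (fun n => \sum_(i < n) q n i * poisson_kernel (ratr r) k.+1%:R^-1 (l n i)) @ \oo -->
  Rintegral mu [set: R] (poisson_kernel (ratr r) k.+1%:R^-1).
Hypothesis cvg_conj_poisson : forall r k,
  (fun n => \sum_(i < n) q n i * conj_poisson_kernel (ratr r) k.+1%:R^-1 (l n i)) @ \oo -->
  Rintegral mu [set: R] (conj_poisson_kernel (ratr r) k.+1%:R^-1).
Hypothesis poisson_bound : \forall n \near \oo, forall eta, 0 < eta ->
  theta ^+ 2 * c n * \sum_(i < n) q n i * poisson_kernel (zeta n) eta (l n i) <= 1.
Hypothesis secular : \forall n \near \oo, c n != 0 ->
  (forall i, (i < n)%N -> zeta n != l n i) ->
  theta * \sum_(i < n) q n i * (zeta n - l n i)^-1 = 1.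

(** A large Poisson integral at [rho] passes to the limit measure at a rational point and then to
    [zeta n]; each move costs a factor [3], hence the [9]. The bound [poisson_bound] then forces
    [c n] to be small. *)
Lemma near_edge rho delta : 0 < delta ->
  (forall K, exists k, K < Rintegral mu [set: R] (poisson_kernel rho k.+1%:R^-1)) ->
  exists2 r, 0 < r & \forall n \near \oo, `|zeta n - rho| <= r -> c n < delta.
Proof.
move=> d0 unb; have [k hk] := unb (9 * (theta ^+ 2 * delta)^-1).
set eta := k.+1%:R^-1 in hk; have e0 : 0 < eta by rewrite invr_gt0.
have td0 : 0 < theta ^+ 2 * delta by rewrite mulr_gt0// exprn_gt0.
(* Convergence is given at rational abscissae only; [eta / 2] leaves room for [zeta n] to be within
   [eta] of this one. *)
have [r] := @rat_in_itvoo R rho (rho + eta / 2) ltac:(by rewrite ltrDl divr_gt0).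
rewrite in_itv /= => /andP[rl rr].
have cmp : Rintegral mu [set: R] (poisson_kernel rho eta) <=
    3 * Rintegral mu [set: R] (poisson_kernel (ratr r) eta).
  have m1 : measurable_fun [set: R] (poisson_kernel rho eta).
    by apply: continuous_measurable_fun; exact: continuous_poisson_kernel.
  have m2 : measurable_fun [set: R] (poisson_kernel (ratr r) eta).
    by apply: continuous_measurable_fun; exact: continuous_poisson_kernel.
  have [M1 b1] := poisson_kernel_bounded rho e0.
  have [M2 b2] := poisson_kernel_bounded (ratr r) e0.
  have i1 := carried_integrable mS muS m1 (fun t _ => b1 t).
  have i2 := carried_integrable mS muS m2 (fun t _ => b2 t).
  rewrite !(carried_integral mS muS)// -RintegralZl//; apply: le_Rintegral => //.
    exact: (integrableZl mS 3 i2).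
  move=> t _; apply: poisson_kernel_compare => //.
  by rewrite ger0_norm; lra.
have lim := @cvg_poisson r k; rewrite -/eta in lim.
have lt3 : 3 * (theta ^+ 2 * delta)^-1 < Rintegral mu [set: R] (poisson_kernel (ratr r) eta).
  by lra.
exists (eta / 2); first by rewrite divr_gt0.
near=> n => zr.
have Qn : 3 * (theta ^+ 2 * delta)^-1 <
    \sum_(i < n) q n i * poisson_kernel (ratr r) eta (l n i).
  by near: n; exact: (cvgr_gt _ lim).
have pb : forall eta, 0 < eta ->
  theta ^+ 2 * c n * \sum_(i < n) q n i * poisson_kernel (zeta n) eta (l n i) <= 1.
  by near: n.
have cmpn : \sum_(i < n) q n i * poisson_kernel (ratr r) eta (l n i) <=
    3 * \sum_(i < n) q n i * poisson_kernel (zeta n) eta (l n i).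
  rewrite mulr_sumr; apply: ler_sum => i _; rewrite mulrCA ler_wpM2l//.
  apply: poisson_kernel_compare => //.
  exact: dist_triangle_half zr rl rr.
have := pb _ e0; set Q := \sum_(i < n) q n i * poisson_kernel (zeta n) eta (l n i) in cmpn *.
have Q1 : (theta ^+ 2 * delta)^-1 < Q.
  by rewrite -(ltr_pM2l (ltr0n R 3)); exact: lt_le_trans Qn cmpn.
move=> bnd; rewrite ltNge; apply/negP => dc.
have : 1 < theta ^+ 2 * c n * Q.
  apply: (@lt_le_trans _ _ (theta ^+ 2 * delta * Q)).
    by rewrite mulrC -ltr_pdivrMr// div1r.
  rewrite ler_wpM2r//; last by rewrite ler_wpM2l// exprn_ge0// ltW.
  by apply: ltW; apply: lt_trans Q1; rewrite invr_gt0.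
by rewrite ltNge bnd.
Unshelve. all: by end_near.
Qed.

(** On the real axis, at distance [d] from [S] and from the atoms, replacing the kernel by its
    regularization at height [eta] costs at most [eta ^+ 2 / d ^+ 3] on either side. *)
Lemma cvg_stieltjes r d : 0 < d -> (forall t, S t -> d <= `|ratr r - t|) ->
  (\forall n \near \oo, forall i, (i < n)%N -> d <= `|ratr r - l n i|) ->
  (fun n => \sum_(i < n) q n i * (ratr r - l n i)^-1) @ \oo --> cauchyG mu (ratr r).
Proof.
move=> d0 dS dl; apply/cvgrPdist_le => e e0.
have [k hk] : exists k, k.+1%:R^-1 ^+ 2 / d ^+ 3 <= e / 3.
  have d3 : 0 < d ^+ 3 by rewrite exprn_gt0.
  exists (Num.truncn (e / 3 * d ^+ 3)^-1).
  rewrite ler_pdivrMr//; set y := e / 3 * d ^+ 3.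
  have y0 : 0 < y by rewrite mulr_gt0// divr_gt0.
  set N := Num.truncn _; have hN : y^-1 < N.+1%:R by apply: truncnS_gt.
  have N1 : N.+1%:R^-1 <= 1 :> R by rewrite invf_le1// ler1n.
  have Np : 0 <= N.+1%:R^-1 :> R by rewrite invr_ge0.
  apply: (@le_trans _ _ N.+1%:R^-1); first by rewrite expr2 ler_piMr.
  by rewrite -[leRHS]invrK lef_pV2 ?posrE ?invr_gt0// ltW.
set eta := k.+1%:R^-1 in hk; have eta0 : 0 < eta by rewrite invr_gt0.
have ap := cauchyG_approx mS muS eta0 d0 dS.
have lim := @cvg_conj_poisson r k; rewrite -/eta in lim.
near=> n.
have n0 : (0 < n)%N by near: n; exact: nbhs_infty_gt.
have dln : forall i, (i < n)%N -> d <= `|ratr r - l n i| by near: n.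
have ln : `|Rintegral mu [set: R] (conj_poisson_kernel (ratr r) eta) -
    \sum_(i < n) q n i * conj_poisson_kernel (ratr r) eta (l n i)| <= e / 3.
  by near: n; move/cvgrPdist_le: lim; apply; rewrite divr_gt0.
set I := Rintegral _ _ _ in ap ln; set Q := \sum_(i < n) _ in ln.
set G := cauchyG _ _ in ap *; set V := \sum_(i < n) _.
have an : `|V - Q| <= e / 3.
  rewrite /V /Q -sumrB (le_trans (ler_norm_sum _ _ _))//.
  apply: le_trans hk; rewrite -[leRHS]mul1r -(q1 n0) mulr_suml; apply: ler_sum => i _.
  rewrite -mulrBr normrM ger0_norm// ler_wpM2l//.
  by apply: conj_poisson_kernel_approx => //; exact: dln.
have -> : G - V = (G - I) + (I - Q) - (V - Q) by ring.
rewrite (le_trans (ler_normB _ _))// (le_trans (lerD (ler_normD _ _) (lexx _)))//.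
by lra.
Unshelve. all: by end_near.
Qed.

Lemma resolvent_fun_decr (x y t : R) : x < y -> t < x \/ y < t -> (y - t)^-1 <= (x - t)^-1.
Proof.
move=> xy [tx|yt].
  by rewrite lef_pV2 ?posrE; lra.
by rewrite lef_nV2 ?negrE; lra.
Qed.

(** If [c n] were nonzero, the weighted transform would equal [theta^-1] at [zeta n]. With no atom
    in between it is at least as large at [ratr r], where it tends to a limit below [theta^-1]. *)
Lemma no_outlier_right r d : 0 < d -> (forall t, S t -> d <= `|ratr r - t|) ->
  (\forall n \near \oo, forall i, (i < n)%N -> d <= `|ratr r - l n i|) ->
  cauchyG mu (ratr r) < theta^-1 ->
  \forall n \near \oo, ratr r < zeta n ->
    (forall i, (i < n)%N -> l n i < ratr r \/ zeta n < l n i) -> c n = 0.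
Proof.
move=> d0 dS dl Gt; have lim := cvg_stieltjes d0 dS dl.
near=> n => rz hl.
have sec : c n != 0 -> (forall i, (i < n)%N -> zeta n != l n i) ->
  theta * \sum_(i < n) q n i * (zeta n - l n i)^-1 = 1 by near: n.
have lt : \sum_(i < n) q n i * (ratr r - l n i)^-1 < theta^-1.
  by near: n; exact: (cvgr_lt _ lim).
apply/eqP; apply: contraTT lt => /sec h; rewrite -leNgt.
have -> : theta^-1 = \sum_(i < n) q n i * (zeta n - l n i)^-1.
  have tn0 : theta != 0 by rewrite gt_eqF.
  rewrite -[RHS](mulKf tn0) h ?mulr1// => i /hl [] hh.
    by rewrite gt_eqF// (lt_trans hh).
  by rewrite lt_eqF.
apply: ler_sum => i _; rewrite ler_wpM2l//; apply: resolvent_fun_decr => //; exact: hl.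
Unshelve. all: by end_near.
Qed.

Lemma no_outlier_left r d : 0 < d -> (forall t, S t -> d <= `|ratr r - t|) ->
  (\forall n \near \oo, forall i, (i < n)%N -> d <= `|ratr r - l n i|) ->
  theta^-1 < cauchyG mu (ratr r) ->
  \forall n \near \oo, zeta n < ratr r ->
    (forall i, (i < n)%N -> l n i < zeta n \/ ratr r < l n i) -> c n = 0.
Proof.
move=> d0 dS dl Gt; have lim := cvg_stieltjes d0 dS dl.
near=> n => rz hl.
have sec : c n != 0 -> (forall i, (i < n)%N -> zeta n != l n i) ->
  theta * \sum_(i < n) q n i * (zeta n - l n i)^-1 = 1 by near: n.
have lt : theta^-1 < \sum_(i < n) q n i * (ratr r - l n i)^-1.
  by near: n; exact: (cvgr_gt _ lim).
apply/eqP; apply: contraTT lt => /sec h; rewrite -leNgt.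
have -> : theta^-1 = \sum_(i < n) q n i * (zeta n - l n i)^-1.
  have tn0 : theta != 0 by rewrite gt_eqF.
  rewrite -[RHS](mulKf tn0) h ?mulr1// => i /hl [] hh.
    by rewrite gt_eqF.
  by rewrite lt_eqF// (lt_trans rz).
apply: ler_sum => i _; rewrite ler_wpM2l//; apply: resolvent_fun_decr => //; exact: hl.
Unshelve. all: by end_near.
Qed.
(** Close to [beta] the infinite Poisson integral acts; further right, the secular equation fails by
    comparison with a test point between the two. *)
Lemma overlap_vanishes_top beta delta : 0 < delta -> (forall t, S t -> t <= beta) ->
  (forall K, exists k, K < Rintegral mu [set: R] (poisson_kernel beta k.+1%:R^-1)) ->
  (forall x, beta < x -> cauchyG mu x < theta^-1) ->
  (forall e, 0 < e -> \forall n \near \oo, beta - e <= zeta n) ->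
  (forall e, 0 < e -> \forall n \near \oo, forall i, (i < n)%N -> l n i <= beta + e) ->
  \forall n \near \oo, c n < delta.
Proof.
move=> d0 Sb unb Glt zb lb.
have [r r0 hr] := near_edge d0 unb.
have [x] := @rat_in_itvoo R beta (beta + r) ltac:(by rewrite ltrDl).
rewrite in_itv /= => /andP[bx xr].
(* Half the distance to [beta]: atoms may exceed [beta] by [d] and still stay [d] away from the test
   point. *)
set d := (ratr x - beta) / 2.
have dd0 : 0 < d by rewrite divr_gt0// subr_gt0.
have dS t : S t -> d <= `|ratr x - t|.
  by move=> /Sb tb; apply: le_trans (ler_norm _); rewrite /d; lra.
have dl : \forall n \near \oo, forall i, (i < n)%N -> d <= `|ratr x - l n i|.
  apply: filterS (lb _ dd0) => n h i /h li.
  by apply: le_trans (ler_norm _); rewrite /d in li *; lra.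
have hx := no_outlier_right dd0 dS dl (Glt _ bx).
near=> n.
have [zr|zr] := lerP (zeta n) (beta + r).
  have : beta - r <= zeta n by near: n; exact: zb.
  move=> zr'; suff : `|zeta n - beta| <= r by near: n.
  by rewrite ler_norml; apply/andP; split; lra.
suff -> : c n = 0 by [].
have li : forall i, (i < n)%N -> l n i <= beta + d by near: n; exact: lb.
have : ratr x < zeta n -> (forall i, (i < n)%N -> l n i < ratr x \/ zeta n < l n i) -> c n = 0.
  by near: n.
apply; first exact: lt_trans zr.
by move=> i /li h; left; apply: le_lt_trans h _; rewrite /d; lra.
Unshelve. all: by end_near.
Qed.

(** Both ends are handled by [near_edge]. In between, the test point is just above [beta] when the
    transform is below [theta^-1], and just below [alpha] when it is above. *)
Lemma overlap_vanishes_gap beta alpha delta : 0 < delta -> beta < alpha ->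
  (forall t, S t -> t <= beta \/ alpha <= t) ->
  (forall K, exists k, K < Rintegral mu [set: R] (poisson_kernel beta k.+1%:R^-1)) ->
  (forall K, exists k, K < Rintegral mu [set: R] (poisson_kernel alpha k.+1%:R^-1)) ->
  (forall x, beta < x < alpha -> cauchyG mu x < theta^-1) \/
  (forall x, beta < x < alpha -> theta^-1 < cauchyG mu x) ->
  (forall e, 0 < e -> \forall n \near \oo, beta - e <= zeta n <= alpha + e) ->
  (forall e, 0 < e -> \forall n \near \oo, forall i, (i < n)%N ->
     l n i <= beta + e \/ alpha - e <= l n i) ->
  \forall n \near \oo, c n < delta.
Proof.
move=> d0 ba Sb unb una Gx zb lb.
have [r1 r10 hr1] := near_edge d0 unb.
have [r2 r20 hr2] := near_edge d0 una.
(* A quarter of the gap keeps the test point inside it and away from the opposite end. *)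
have [r [r0 rr1 rr2 rg]] : exists r, [/\ 0 < r, r <= r1, r <= r2 & r <= (alpha - beta) / 4].
  exists (Num.min r1 (Num.min r2 ((alpha - beta) / 4))).
  by rewrite !lt_min r10 r20 divr_gt0 ?subr_gt0// !ge_min !lexx !orbT.
suff [d [[dd0 dr] hd]] : exists d, (0 < d /\ d <= r) /\ \forall n \near \oo,
   beta + r < zeta n < alpha - r ->
   (forall i, (i < n)%N -> l n i <= beta + d \/ alpha - d <= l n i) -> c n = 0.
  near=> n.
  have /andP[zl zu] : beta - r <= zeta n <= alpha + r by near: n; exact: zb.
  have [zr|zr] := lerP (zeta n) (beta + r).
    suff : `|zeta n - beta| <= r1 by near: n.
    by rewrite ler_norml; apply/andP; split; lra.
  have [zr'|zr'] := lerP (alpha - r) (zeta n).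
    suff : `|zeta n - alpha| <= r2 by near: n.
    by rewrite ler_norml; apply/andP; split; lra.
  suff -> : c n = 0 by [].
  have li : forall i, (i < n)%N -> l n i <= beta + d \/ alpha - d <= l n i.
    by near: n; exact: lb.
  have : beta + r < zeta n < alpha - r ->
    (forall i, (i < n)%N -> l n i <= beta + d \/ alpha - d <= l n i) -> c n = 0 by near: n.
  by apply => //; rewrite zr zr'.
case: Gx => Gx.
  have [x] := @rat_in_itvoo R beta (beta + r) ltac:(by rewrite ltrDl).
  rewrite in_itv /= => /andP[bx xr].
  have xgap : beta < ratr x < alpha by rewrite bx /=; lra.
  exists ((ratr x - beta) / 2); set d := (ratr x - beta) / 2.
  have dd0 : 0 < d by rewrite divr_gt0// subr_gt0.
  have sep t : t <= beta + d \/ alpha - d <= t -> d <= `|ratr x - t|.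
    case=> ht; first by apply: le_trans (ler_norm _); rewrite /d in ht *; lra.
    by rewrite distrC; apply: le_trans (ler_norm _); rewrite /d in ht *; lra.
  have dS t : S t -> d <= `|ratr x - t|.
    by move=> /Sb h; apply: sep; case: h => h; [left|right]; lra.
  have dl : \forall n \near \oo, forall i, (i < n)%N -> d <= `|ratr x - l n i|.
    by apply: filterS (lb _ dd0) => n h i /h /sep.
  split; first by split => //; rewrite /d; lra.
  have := no_outlier_right dd0 dS dl (Gx _ xgap).
  apply: filterS => n h /andP[z1 z2] hl; apply: h; first exact: lt_trans z1.
  by move=> i /hl [] hi; [left|right]; rewrite /d in hi; lra.
have [x] := @rat_in_itvoo R (alpha - r) alpha ltac:(by rewrite gtrBl).
rewrite in_itv /= => /andP[xr xa].
have xgap : beta < ratr x < alpha by rewrite xa andbT; lra.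
exists ((alpha - ratr x) / 2); set d := (alpha - ratr x) / 2.
have dd0 : 0 < d by rewrite divr_gt0// subr_gt0.
have sep t : t <= beta + d \/ alpha - d <= t -> d <= `|ratr x - t|.
  case=> ht; first by apply: le_trans (ler_norm _); rewrite /d in ht *; lra.
  by rewrite distrC; apply: le_trans (ler_norm _); rewrite /d in ht *; lra.
have dS t : S t -> d <= `|ratr x - t|.
  by move=> /Sb h; apply: sep; case: h => h; [left|right]; lra.
have dl : \forall n \near \oo, forall i, (i < n)%N -> d <= `|ratr x - l n i|.
  by apply: filterS (lb _ dd0) => n h i /h /sep.
split; first by split => //; rewrite /d; lra.
have := no_outlier_left dd0 dS dl (Gx _ xgap).
apply: filterS => n h /andP[z1 z2] hl; apply: h; first exact: lt_trans xr.
by move=> i /hl [] hi; [left|right]; rewrite /d in hi; lra.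
Unshelve. all: by end_near.
Qed.
End SpectralMeasureSequence.

(** * Asymptotics of the perturbed eigenvalue *)

Lemma bands_nonincreasing (R : realType) (ell : nat) (a b : nat -> R) :
  (forall k, (1 <= k <= ell)%N -> a k < b k) ->
  (forall k, (1 <= k < ell)%N -> b k.+1 < a k) ->
  forall k k', (1 <= k)%N -> (k <= k')%N -> (k' <= ell)%N -> b k' <= b k /\ a k' <= a k.
Proof.
move=> ab ba k k' k1; elim: k' => [|k' IH]; first by rewrite leqn0 => /eqP ->.
rewrite leq_eqVlt => /orP[/eqP <- //|]; rewrite ltnS => kk' k'l.
have [IHb IHa] := IH kk' (ltnW k'l).
have h1 := ab k'.+1 ltac:(by rewrite k'l).
have h2 := ba k' ltac:(by rewrite k'l (leq_trans k1)).
have h3 := ab k' ltac:(by rewrite (ltnW k'l) (leq_trans k1)).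
by split; lra.
Qed.

Lemma mixture_null (R : realType) (ell : nat) (p : nat -> R) (mu : nat -> probability R R)
    (muX : probability R R) (A : set R) :
  measurable A ->
  (forall A, measurable A -> muX A = (\sum_(1 <= k < ell.+1) (p k)%:E * mu k A)%E) ->
  (forall k, (1 <= k <= ell)%N -> mu k A = 0%E) -> muX A = 0%E.
Proof.
move=> mA -> // h; rewrite big_nat big1// => k kl.
by rewrite h ?mule0.
Qed.

(** The midpoint [y] gives strictness: [G x < G y], and [G y] is at most the limit. *)
Lemma decr_lt_right_limit (R : realType) (G : R -> R) (beta x t : R) (g : \bar R) :
  beta < x -> (forall y z, beta < y -> y < z -> z <= x -> G z < G y) ->
  (G z)%:E @[z --> beta^'+] --> g -> (g <= t%:E)%E -> G x < t.
Proof.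
move=> bx dec lim gt; set y := (beta + x) / 2.
have by1 : beta < y by rewrite /y; lra.
have yx : y < x by rewrite /y; lra.
apply: (lt_le_trans (dec y x by1 yx (lexx _))).
rewrite -lee_fin; apply: le_trans gt; rewrite -(cvg_lim _ lim)//.
apply: lime_ge; first by apply/cvg_ex; exists g.
near=> z; rewrite lee_fin; apply/ltW/dec; last exact: ltW.
  by near: z; exact: nbhs_right_gt.
by near: z; exact: nbhs_right_lt.
Unshelve. all: by end_near.
Qed.

Lemma decr_gt_left_limit (R : realType) (G : R -> R) (alpha x t : R) (g : \bar R) :
  x < alpha -> (forall y z, x <= y -> y < z -> z < alpha -> G z < G y) ->
  (G z)%:E @[z --> alpha^'-] --> g -> (t%:E <= g)%E -> t < G x.
Proof.
move=> xa dec lim gt; set y := (alpha + x) / 2.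
have ya : y < alpha by rewrite /y; lra.
have xy : x < y by rewrite /y; lra.
apply: (le_lt_trans _ (dec x y (lexx _) xy ya)).
rewrite -lee_fin; apply: (le_trans gt); rewrite -(cvg_lim _ lim)//.
apply: lime_le; first by apply/cvg_ex; exists g.
near=> z; rewrite lee_fin; apply/ltW/dec; first exact: ltW.
  by near: z; exact: nbhs_left_gt.
by near: z; exact: nbhs_left_lt.
Unshelve. all: by end_near.
Qed.

Lemma ceiln0 (R : realType) n : ceiln n (0 : R) = 0%N.
Proof. by rewrite /ceiln mulr0 ceil0. Qed.

Lemma ceilnE (R : realType) n (x : R) : 0 <= x -> ((ceiln n x)%:Z = Num.ceil (n%:R * x))%R.
Proof.
move=> x0; rewrite /ceiln gez0_abs//.
have nx : 0 <= n%:R * x by rewrite mulr_ge0.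
by rewrite -(ler_int R) (le_trans nx)// Num.Theory.ceil_ge.
Qed.

Lemma ceiln_gt0 (R : realType) n (x : R) : (0 < n)%N -> 0 < x -> (0 < ceiln n x)%N.
Proof.
move=> n0 x0; have nx : 0 < n%:R * x by rewrite mulr_gt0// ltr0n.
rewrite -ltz_nat ceilnE ?ltW// -(ltr_int R); exact: lt_le_trans (Num.Theory.ceil_ge _).
Qed.

(** As soon as [n%:R * (1 - x)] reaches [1]; the index of the eigenvalue studied is then a genuine
    one, not the default of [nth] in [lam]. *)
Lemma ceiln_lt_near (R : realType) (x : R) : 0 <= x -> x < 1 ->
  \forall n \near \oo, ((ceiln n x).+1 <= n)%N.
Proof.
move=> x0 x1; near=> n.
have nb : (1 - x)^-1 <= n%:R by near: n; exact: nbhs_infty_ger.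
have d0 : 0 < 1 - x by rewrite subr_gt0.
have h : 1 <= n%:R * (1 - x) by rewrite -ler_pdivrMr// div1r.
have c1 : Num.ceil (n%:R * x) < n%:Z.
  rewrite -(ltr_int R); apply: (@lt_le_trans _ _ (n%:R * x + 1)).
    by have := Num.Theory.ceilB1_lt (n%:R * x); rewrite intrB ltrBlDr.
  by move: h; rewrite mulrBr mulr1 /=; lra.
by rewrite -ltz_nat ceilnE.
Unshelve. all: by end_near.
Qed.

(** * Interlacing under a rank one perturbation *)

Lemma adjmxD (R : realType) m n (A B : 'M[R[i]]_(m, n)) :
  adjmx (A + B) = adjmx A + adjmx B.
Proof. by apply/matrixP => i j; rewrite !mxE rmorphD. Qed.

Lemma hermitian_add_rank1 (R : realType) n (X : 'M[R[i]]_n) (v : 'cV[R[i]]_n) (theta : R) :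
  is_hermitian X -> is_hermitian (X + (theta%:C)%C *: (v *m adjmx v)).
Proof.
move=> hX; rewrite /is_hermitian adjmxD hX adjmxZ conjC_realc adjmxM.
by rewrite adjmxK.
Qed.

Lemma quad_add_rank1 (R : realType) n (X : 'M[R[i]]_n) (v x : 'cV[R[i]]_n) (theta : R) :
  complex.Re ((adjmx x *m (X + (theta%:C)%C *: (v *m adjmx v)) *m x) 0 0) =
  complex.Re ((adjmx x *m X *m x) 0 0) + theta * sqn ((adjmx v *m x) 0 0).
Proof.
rewrite mulmxDr mulmxDl mxE ReD; congr (_ + _).
rewrite -scalemxAr -scalemxAl mxE Re_scale; congr (_ * _).
have -> : adjmx x *m (v *m adjmx v) *m x = adjmx (adjmx v *m x) *m (adjmx v *m x).
  by rewrite adjmxM adjmxK !mulmxA.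
by rewrite mxE big_ord1 adjmxE conj_mul_self.
Qed.

(** The perturbation is positive, so the forms compare on the whole space and the constraint matrix
    is empty. *)
Lemma rank1_interlacing_ge (R : realType) n (X : 'M[R[i]]_n) (v : 'cV[R[i]]_n) (theta : R) m :
  is_hermitian X -> 0 <= theta -> (m < n)%N ->
  lam X m.+1 <= lam (X + (theta%:C)%C *: (v *m adjmx v)) m.+1.
Proof.
move=> hX t0 mn; have := @interlacing _ _ _ _ m 0 (0 : 'M[R[i]]_(0, n)) (hermitian_add_rank1 v theta hX) hX.
rewrite addn0; apply => //.
by move=> x _; rewrite quad_add_rank1 lerDl mulr_ge0 ?sqn_ge0.
Qed.

(** The two forms agree on the hyperplane orthogonal to [v], which costs one index. *)
Lemma rank1_interlacing_le (R : realType) n (X : 'M[R[i]]_n) (v : 'cV[R[i]]_n) (theta : R) m :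
  is_hermitian X -> (m.+1 < n)%N ->
  lam (X + (theta%:C)%C *: (v *m adjmx v)) m.+2 <= lam X m.+1.
Proof.
move=> hX mn; have := @interlacing _ _ _ _ m 1 (adjmx v) hX (hermitian_add_rank1 v theta hX).
rewrite addn1; apply => //.
by move=> x vx; rewrite quad_add_rank1 vx [X in sqn X]mxE sqn_real expr0n /= mulr0 addr0.
Qed.

(** Two consecutive ordered eigenvalues leave no eigenvalue strictly between them; [0 < m] guards
    the case where the lower one is the largest of all. *)
Lemma empty_spectral_tail (R : realType) n (X : 'M[R[i]]_n) m beta alpha :
  is_hermitian X -> (m < n)%N -> lam X m.+1 <= beta ->
  ((0 < m)%N -> alpha <= lam X m) ->
  forall i, (i < n)%N -> lam X i.+1 <= beta \/ (0 < m)%N /\ alpha <= lam X i.+1.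
Proof.
move=> hX mn lb la i il; have [mi|im] := leqP m i.
  by left; apply: le_trans lb; exact: lam_sorted.
have m0 : (0 < m)%N by exact: leq_ltn_trans im.
right; split => //; apply: (le_trans (la m0)).
rewrite -[X in lam _ X](prednK m0); apply: lam_sorted => //; first by rewrite -ltnS prednK.
by rewrite prednK// ltnW.
Qed.

(** * Almost sure vanishing of the overlap with the perturbation direction *)

Theorem mainTheorem5 (R : realType) (d : measure_display) (T : measurableType d)
  (Pr : probability T R) (real_case : bool)
  (X : forall n : nat, T -> 'M[R[i]]_n) (Pn : forall n : nat, 'M[R[i]]_n) (theta : R)
  (ell : nat) (p a b : nat -> R) (mu : nat -> probability R R) (muX : probability R R)
  (j : nat) :
  (* X_n : random Hermitian (resp. real symmetric) matrices, conjugation invariant *)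
  (forall n, random_mx (X n)) ->
  (forall n w, is_hermitian (X n w) /\ over_field real_case (X n w)) ->
  (forall n, conj_invariant real_case Pr (X n)) ->
  (* the limit measure mu_X = sum_j p_j mu_j *)
  (forall k, (1 <= k <= ell)%N -> 0 < p k) ->
  \sum_(1 <= k < ell.+1) p k = 1 ->
  (forall k, (1 <= k <= ell)%N -> a k < b k) ->
  (forall k, (1 <= k < ell)%N -> b k.+1 < a k) ->
  (forall k, (1 <= k <= ell)%N -> mu k `[a k, b k] = 1%E) ->
  (forall k, (1 <= k <= ell)%N -> forall z, a k < z < b k ->
     forall e : R, 0 < e -> (0 < mu k `](z - e)%R, (z + e)%R[)%E) ->
  (forall A, measurable A -> muX A = (\sum_(1 <= k < ell.+1) (p k)%:E * mu k A)%E) ->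
  (* a.s. weak convergence of the empirical eigenvalue distribution *)
  {ae Pr, forall w, forall f : R -> R, continuous f -> (exists M, forall x, `|f x| <= M) ->
     (fun n => emp_integral (X n w) f) @ \oo --> Rintegral muX setT f} ->
  (* a.s. convergence of the edge eigenvalues *)
  (forall k, (1 <= k <= ell)%N ->
     {ae Pr, forall w,
        (fun n => lam (X n w) (ceiln n (cum p k.-1)).+1) @ \oo --> b k /\
        (fun n => lam (X n w) (ceiln n (cum p k))) @ \oo --> a k}) ->
  (* P_n : deterministic rank one perturbation with nonzero eigenvalue theta > 0 *)
  0 < theta ->
  (forall n, (0 < n)%N ->
     [/\ is_hermitian (Pn n), over_field real_case (Pn n), \rank (Pn n) = 1%N
       & eigenvalue (Pn n) (theta%:C)%C]) ->
  (* conditions on j *)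
  (1 <= j <= ell)%N ->
  (exists ga gb : \bar R,
     [/\ (j = 1%N /\ ga = 0%E) \/
         ((1 < j)%N /\ (cauchyG muX z)%:E @[z --> (a j.-1)^'-] --> ga),
       (cauchyG muX z)%:E @[z --> (b j)^'+] --> gb
       & ~ (ga < (theta^-1)%:E < gb)%E]) ->
  ((derive1 (cauchyG muX) z)%:E @[z --> (b j)^'+] --> -oo%E) ->
  ((1 < j)%N -> (derive1 (cauchyG muX) z)%:E @[z --> (a j.-1)^'-] --> -oo%E) ->
  (* conclusion, for any choice of unit eigenvectors *)
  forall u : forall n : nat, T -> 'cV[R[i]]_n,
  (forall n w, ((ceiln n (cum p j.-1)).+1 <= n)%N ->
     [/\ vnorm (u n w) = 1, over_field real_case (u n w)
       & (X n w + Pn n) *m u n w =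
           (lam (X n w + Pn n) (ceiln n (cum p j.-1)).+1)%:C%C *: u n w]) ->
  {ae Pr, forall w,
     (fun n => proj_norm (u n w) (kerc ((theta%:C)%C%:M - Pn n))) @ \oo --> 0}.
Proof.
move=> mX hX cX p0 psum ab ba muk _ muXE weak edge theta0 hP /andP[j1 jl].
move=> [ga [gb [gaE gbE gab]]] dbj daj u hu.
have j_ell : (1 <= j <= ell)%N by rewrite j1 jl.
have order := bands_nonincreasing ab ba.
(* A bounded set carrying [muX] and avoiding the gap above [b j]; for [j = 1] its upper part is
   empty. *)
pose S := `[a ell, b 1%N] `&` (`]-oo, b j] `|` [set t | (1 < j)%N /\ a j.-1 <= t]).
have mS : measurable S.
  apply: measurableI => //; apply: measurableU => //.
  case: (ltnP 1 j) => h.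
    rewrite (_ : [set t | _] = `[a j.-1, +oo[%classic)//.
    by apply/seteqP; split=> t /=; rewrite in_itv /= andbT => //; case.
  by rewrite (_ : [set t | _] = set0)//; apply/seteqP; split=> t //= [].
have muS : muX (~` S) = 0%E.
  apply: (mixture_null (measurableC mS) muXE) => k kl.
  have nk : mu k (~` `[a k, b k]) = 0%E.
    by rewrite probability_setC// [X in (1 - X)%E]muk// subee.
  have mI : measurable (~` `[a k, b k]) by exact: measurableC.
  apply: (subset_measure0 (measurableC mS) mI _ nk).
  apply: subsetC => t /=; rewrite in_itv /= => /andP[t1 t2].
  case/andP: kl => k1 kell.
  have [_ h1] := order k ell k1 kell (leqnn _).
  have [h2 _] := order 1%N k (leqnn _) k1 kell.
  split; first by rewrite /= in_itv /= (le_trans h1)//= (le_trans t2).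
  have [jk|kj] := leqP j k.
    left; rewrite /= in_itv /=; apply: (le_trans t2).
    by have [] := order j k j1 jk kell.
  right; split; first exact: leq_ltn_trans kj.
  apply: le_trans t1.
  have kj' : (k <= j.-1)%N by rewrite -ltnS prednK.
  by have [] := order k j.-1 k1 kj' (leq_trans (leq_pred _) jl).
have bS t : S t -> a ell <= t <= b 1%N by case=> /=; rewrite in_itv.
have [v hv] : exists v : forall n, 'cV[R[i]]_n, forall n, (0 < n)%N ->
    [/\ adjmx (v n) *m v n = 1%:M, over_field real_case (v n) &
      Pn n = (theta%:C)%C *: (v n *m adjmx (v n))].
  have h n : exists v : 'cV[R[i]]_n, (0 < n)%N ->
    [/\ adjmx v *m v = 1%:M, over_field real_case v & Pn n = (theta%:C)%C *: (v *m adjmx v)].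
    have [->|n0] := posnP n; first by exists 0.
    have [h1 h2 h3 h4] := hP n n0.
    by have [v hv] := rank1_hermitian theta0 h1 h2 h3 h4; exists v.
  by exists (fun n => sval (cid (h n))) => n; exact: (svalP (cid (h n))).
have A1 := fluct_ae_cvg0 mX (fun n w => (hX n w).1) cX
  (fun n n0 => let: And3 e1 e2 _ := hv n n0 in conj e1 e2).
(* For [j = 1] there is no band above, and the guard makes the claim vacuous. *)
have A4 : {ae Pr, forall w, (1 < j)%N ->
    (fun n => lam (X n w) (ceiln n (cum p j.-1))) @ \oo --> a j.-1}.
  have [h|h] := ltnP 1 j; last by apply: aeW.
  have : (1 <= j.-1 <= ell)%N by rewrite -ltnS prednK// h (leq_trans (leq_pred _) jl).
  by move=> /edge; apply: filterS => w [].
have A3 := edge j j_ell.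
(* The sample [w] is fixed from here on, and the rest is deterministic. *)
apply: filterS (filterI (filterI A1 weak) (filterI A3 A4)) => w [[h1 h2] [[h3 _] h4]].
pose W n := sval (cid (hermitian_eigenbasis (hX n w).1)).
have eW n : eigenbasis (X n w) (W n) by exact: (svalP (cid (hermitian_eigenbasis (hX n w).1))).
pose l n i := lam (X n w) i.+1.
(* Weights indexed by natural numbers, extended by [0] from [n] on. *)
pose q n i := oapp (spectral_weight (W n) (v n)) 0 (insub i : option 'I_n).
have qE n (i : 'I_n) : q n i = spectral_weight (W n) (v n) i by rewrite /q valK.
pose m n := ceiln n (cum p j.-1).
pose zeta n := lam (X n w + Pn n) (m n).+1.
pose c n := sqn ((adjmx (v n) *m u n w) 0 0).
have cum_ge0 : 0 <= cum p j.-1.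
  rewrite /cum big_nat; apply: sumr_ge0 => k; rewrite prednK// => /andP[k1 kj].
  by apply/ltW/p0; rewrite k1 (leq_trans (ltnW kj)).
have cum_lt1 : cum p j.-1 < 1.
  rewrite -psum /cum prednK// (big_cat_nat j1 (leqW jl))/=.
  rewrite ltrDl big_ltn ?ltnS// ltr_wpDr ?p0//.
  rewrite big_nat; apply: sumr_ge0 => k /andP[k1 kj].
  by apply/ltW/p0; rewrite (leq_trans j1 (ltnW k1)) -ltnS.
have cum_gt0 : (1 < j)%N -> 0 < cum p j.-1.
  move=> h; rewrite /cum prednK// big_ltn// ltr_wpDr//; last first.
    by apply: p0; rewrite (leq_trans j1 jl).
  rewrite big_nat; apply: sumr_ge0 => k /andP[k1 kj].
  by apply/ltW/p0; rewrite (ltnW k1) (leq_trans (ltnW kj)).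
have mlt : \forall n \near \oo, (m n < n)%N by exact: ceiln_lt_near.
have q0 n i : 0 <= q n i.
  by rewrite /q; case: insubP => //= k _ _; exact: sqn_ge0.
have q1 n : (0 < n)%N -> \sum_(i < n) q n i = 1.
  move=> n0; have [v1 _ _] := hv n n0.
  by rewrite -(spectral_weight_sum (eW n) v1); apply: eq_bigr => i _; rewrite qE.
have pois r k : (fun n => \sum_(i < n) q n i * poisson_kernel (ratr r) k.+1%:R^-1 (l n i)) @ \oo -->
    Rintegral muX [set: R] (poisson_kernel (ratr r) k.+1%:R^-1).
  have e0 : 0 < k.+1%:R^-1 :> R by rewrite invr_gt0.
  have en : k.+1%:R^-1 != 0 :> R by rewrite gt_eqF.
  have [_ lim] := h1 r k.
  have lim2 := h2 _ (continuous_poisson_kernel e0) (poisson_kernel_bounded (ratr r) e0).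
  (* The factor undoes the [- eta] by which the imaginary part of [fluct] multiplies the difference
     of Poisson integrals. *)
  have lim3 : (fun n => emp_integral (X n w) (poisson_kernel (ratr r) k.+1%:R^-1) +
    (- (k.+1%:R^-1)^-1) * complex.Im (fluct (spectral_point R r k) (v n) (X n w))) @ \oo -->
    Rintegral muX [set: R] (poisson_kernel (ratr r) k.+1%:R^-1) + (- (k.+1%:R^-1)^-1) * 0.
    by apply: cvgD => //; apply: cvgM => //; exact: cvg_cst.
  rewrite mulr0 addr0 in lim3; apply: cvg_trans lim3; apply: near_eq_cvg.
  apply: nearW => n.
  rewrite (Im_fluct _ _ en (eW n)) mulrA mulrNN mulVf// mul1r addrC subrK.
  by apply: eq_bigr => i _; rewrite qE.
have cpois r k : (fun n => \sum_(i < n) q n i * conj_poisson_kernel (ratr r) k.+1%:R^-1 (l n i)) @ \oo -->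
    Rintegral muX [set: R] (conj_poisson_kernel (ratr r) k.+1%:R^-1).
  have e0 : 0 < k.+1%:R^-1 :> R by rewrite invr_gt0.
  have en : k.+1%:R^-1 != 0 :> R by rewrite gt_eqF.
  have [lim _] := h1 r k.
  have lim2 := h2 _ (continuous_conj_poisson_kernel e0) (conj_poisson_kernel_bounded (ratr r) e0).
  rewrite -[X in _ --> X]addr0.
  rewrite (_ : (fun n => _) = (fun n => emp_integral (X n w) (conj_poisson_kernel (ratr r) k.+1%:R^-1) +
    complex.Re (fluct (spectral_point R r k) (v n) (X n w)))); first exact: cvgD.
  apply/funext => n; rewrite (Re_fluct _ _ en (eW n)) addrC subrK.
  by apply: eq_bigr => i _; rewrite qE.
have uE n : (m n < n)%N -> vnorm (u n w) = 1 /\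
    (X n w + (theta%:C)%C *: (v n *m adjmx (v n))) *m u n w = ((zeta n)%:C)%C *: u n w.
  move=> mn; have [_ _ <-] := hv n (leq_ltn_trans (leq0n _) mn).
  by have [h _ e] := hu n w mn.
have pb : \forall n \near \oo, forall eta, 0 < eta ->
  theta ^+ 2 * c n * \sum_(i < n) q n i * poisson_kernel (zeta n) eta (l n i) <= 1.
  apply: filterS mlt => n mn eta e0; have [un ue] := uE n mn.
  have := eigvec_poisson_bound (eW n) un ue e0.
  by under eq_bigr do rewrite -qE.
have sec : \forall n \near \oo, c n != 0 -> (forall i, (i < n)%N -> zeta n != l n i) ->
  theta * \sum_(i < n) q n i * (zeta n - l n i)^-1 = 1.
  apply: filterS mlt => n mn cn zl; have [un ue] := uE n mn.
  have := secular_equation (eW n) ue cn (fun i => zl i (ltn_ord i)).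
  by under eq_bigr do rewrite -qE.
have zge e : 0 < e -> \forall n \near \oo, b j - e <= zeta n.
  move=> e0; near=> n.
  have mn : (m n < n)%N by near: n.
  have [_ _ PE] := hv n (leq_ltn_trans (leq0n _) mn).
  rewrite /zeta PE; apply: le_trans (rank1_interlacing_ge (v n) (hX n w).1 (ltW theta0) mn).
  near: n; apply: (cvgr_ge _ h3); by rewrite gtrBl.
(* Here [m n] is positive because [cum p j.-1] is, so an eigenvalue of [X n w] of index [m n] exists
   and bounds [zeta n] from above. *)
have zle e : (1 < j)%N -> 0 < e -> \forall n \near \oo, zeta n <= a j.-1 + e.
  move=> jj e0; near=> n.
  have mn : (m n < n)%N by near: n.
  have n0 : (0 < n)%N by exact: leq_ltn_trans mn.
  have [_ _ PE] := hv n n0.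
  have m0 : (0 < m n)%N by apply: ceiln_gt0 => //; exact: cum_gt0.
  rewrite /zeta PE -(prednK m0); rewrite -(prednK m0) in mn.
  apply: le_trans (rank1_interlacing_le (v n) theta (hX n w).1 mn) _.
  rewrite prednK//; near: n; apply: (cvgr_le _ (h4 jj)); by rewrite ltrDl.
have lub e : 0 < e -> \forall n \near \oo, lam (X n w) (m n).+1 <= b j + e.
  by move=> e0; apply: (cvgr_le _ h3); rewrite ltrDl.
have tail e : 0 < e -> \forall n \near \oo, forall i, (i < n)%N ->
    l n i <= b j + e \/ (1 < j)%N /\ a j.-1 - e <= l n i.
  move=> e0; have [jj|jj] := ltnP 1 j.
    near=> n.
    have mn : (m n < n)%N by near: n.
    have hl : lam (X n w) (m n).+1 <= b j + e by near: n; exact: lub.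
    have ha : a j.-1 - e <= lam (X n w) (m n).
      by near: n; apply: (cvgr_ge _ (h4 jj)); rewrite gtrBl.
    move=> i /(empty_spectral_tail (hX n w).1 mn hl (fun _ => ha)) [|[_]]; first by left.
    by right.
  near=> n => i ilt; left.
  have mn : (m n < n)%N by near: n.
  have hl : lam (X n w) (m n).+1 <= b j + e by near: n; exact: lub.
  (* For [j = 1] the eigenvalue of index [(m n).+1] is the largest one. *)
  apply: le_trans hl; have -> : m n = 0%N.
    rewrite /m (_ : j.-1 = 0%N); last by move: j1 jj; clear; case: j => [|[|]].
    by rewrite /cum big_geq// ceiln0.
  exact: lam_sorted (hX n w).1 _ ilt.
(* The projection norm is the square root of [c n], so [delta] is taken to be [e ^+ 2]. *)
suff concl delta : 0 < delta -> \forall n \near \oo, c n < delta.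
  apply/cvgr0Pnorm_lt => e e0; near=> n.
  have mn : (m n < n)%N by near: n.
  have [v1 _ PE] := hv n (leq_ltn_trans (leq0n _) mn).
  rewrite PE proj_norm_rank1 ?gt_eqF// ger0_norm ?sqrtr_ge0//.
  rewrite -[ltRHS]ger0_norm ?ltW// -sqrtr_sqr ltr_sqrt ?exprn_gt0//.
  by near: n; apply: concl; rewrite exprn_gt0.
move=> d0.
have Sgap t : S t -> t <= b j \/ (1 < j)%N /\ a j.-1 <= t.
  by case=> _ [ht|ht]; [left; move: ht; rewrite /= in_itv|right].
(* By monotonicity, these cases put the transform entirely above, respectively below, [theta^-1] on
   the gap. *)
have gb_le : ~ (ga < (theta^-1)%:E)%E \/ (gb <= (theta^-1)%:E)%E.
  have [h1'|h1'] := boolP (ga < (theta^-1)%:E)%E; last by left; exact/negP.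
  by right; rewrite leNgt; apply/negP => h2'; apply: gab; rewrite h1' h2'.
have [jj|jj] := ltnP 1 j.
  have gap : b j < a j.-1.
    by have := ba j.-1; rewrite prednK//; apply; rewrite jl andbT -ltnS prednK.
  have Sgap' t : S t -> t <= b j \/ a j.-1 <= t by move=> /Sgap [|[]]; [left|right].
  have sep x : b j < x < a j.-1 -> exists2 delta, 0 < delta & forall t, S t -> delta <= `|x - t|.
    move=> /andP[x1 x2]; exists (Num.min (x - b j) (a j.-1 - x)); first by rewrite lt_min !subr_gt0 x1.
    move=> t /Sgap' [ht|ht]; rewrite ge_min; apply/orP; [left|right].
      by apply: le_trans (ler_norm _); rewrite lerB.
    by rewrite distrC; apply: le_trans (ler_norm _); rewrite lerB.
  have decr x y : b j < x -> x < y -> y < a j.-1 -> cauchyG muX y < cauchyG muX x.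
    move=> x1 xy y1; apply: (cauchyG_decr mS muS bS xy).
    - move=> t /Sgap' [ht|ht].
        by rewrite mulr_gt0// subr_gt0 (le_lt_trans ht)// (lt_trans x1).
      by rewrite nmulr_rgt0 subr_lt0 (lt_le_trans _ ht)// (lt_trans xy).
    - by apply: sep; rewrite x1 (lt_trans xy).
    - by apply: sep; rewrite y1 (lt_trans x1).
  have unb := @poisson_unbounded _ _ _ mS muS _ _ (b j) dbj.
  have una := @poisson_unbounded _ _ _ mS muS _ _ (a j.-1) (daj jj).
  (* On its own side of the midpoint, each end of the gap is at least as close as any point of [S],
     as [poisson_unbounded] requires. *)
  have mid : b j < (b j + a j.-1) / 2 by lra.
  have mid' : (b j + a j.-1) / 2 < a j.-1 by lra.
  apply: (@overlap_vanishes_gap _ _ _ mS muS q l zeta c theta theta0 q0 q1 pois cpois pb sec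
    (b j) (a j.-1) delta d0 gap Sgap').
  - apply: unb; near=> z.
    have z1 : b j < z by near: z; exact: nbhs_right_gt.
    have z2 : z < (b j + a j.-1) / 2 by near: z; exact: nbhs_right_lt.
    split; first by rewrite gt_eqF.
    move=> t /Sgap' ht; rewrite ger0_norm ?subr_ge0 ?(ltW z1)//.
    case: ht => ht; first by apply: le_trans (ler_norm _); rewrite lerB.
    by rewrite distrC; apply: le_trans (ler_norm _); lra.
  - apply: una; near=> z.
    have z1 : z < a j.-1 by near: z; exact: nbhs_left_lt.
    have z2 : (b j + a j.-1) / 2 < z by near: z; exact: nbhs_left_gt.
    split; first by rewrite lt_eqF.
    move=> t /Sgap' ht; rewrite distrC ger0_norm ?subr_ge0 ?(ltW z1)//.
    case: ht => ht; first by apply: le_trans (ler_norm _); lra.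
    by rewrite distrC; apply: le_trans (ler_norm _); rewrite lerB.
  - case: gb_le => [/negP|] hg; [right|left] => x /andP[x1 x2].
      have gaE' : (cauchyG muX z)%:E @[z --> (a j.-1)^'-] --> ga.
        by case: gaE => [[j1' _]|[]//]; move: jj; rewrite j1'.
      apply: (decr_gt_left_limit x2 _ gaE'); last by rewrite leNgt.
      by move=> y z xy yz za; apply: decr => //; exact: lt_le_trans xy.
    apply: (decr_lt_right_limit x1 _ gbE hg) => y z by1 yz zx.
    by apply: decr => //; exact: le_lt_trans x2.
  - move=> e e0; near=> n; apply/andP; split; near: n; [exact: zge|exact: zle].
  - move=> e e0; apply: filterS (tail e e0) => n h i /h [|[]]; first by left.
    by right.
have Sb t : S t -> t <= b j by move=> /Sgap [//|[]]; rewrite ltnNge jj.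
(* For [j = 1], [ga = 0] lies below [theta^-1], which excludes the first case. *)
have gb_le' : (gb <= (theta^-1)%:E)%E.
  case: gb_le => //; case: gaE => [[_ ->]|[]]; last by rewrite ltnNge jj.
  by rewrite lte_fin invr_gt0 theta0.
have decr x y : b j < x -> x < y -> cauchyG muX y < cauchyG muX x.
  move=> x1 xy; have y1 := lt_trans x1 xy; apply: (cauchyG_decr mS muS bS xy).
  - by move=> t /Sb ht; rewrite mulr_gt0// subr_gt0 (le_lt_trans ht).
  - exists (x - b j); first by rewrite subr_gt0.
    by move=> t /Sb ht; apply: le_trans (ler_norm _); rewrite lerB.
  - exists (y - b j); first by rewrite subr_gt0.
    by move=> t /Sb ht; apply: le_trans (ler_norm _); rewrite lerB.
have unb := @poisson_unbounded _ _ _ mS muS _ _ (b j) dbj.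
apply: (@overlap_vanishes_top _ _ _ mS muS q l zeta c theta theta0 q0 q1 pois cpois pb sec
    (b j) delta d0 Sb).
- apply: unb; near=> z.
  have z1 : b j < z by near: z; exact: nbhs_right_gt.
  split; first by rewrite gt_eqF.
  move=> t /Sb ht; rewrite ger0_norm ?subr_ge0 ?(ltW z1)//.
  by apply: le_trans (ler_norm _); rewrite lerB.
- move=> x x1; apply: (decr_lt_right_limit x1 _ gbE gb_le') => y z by1 yz _.
  exact: decr.
- exact: zge.
- move=> e e0; apply: filterS (tail e e0) => n h i /h [//|[]].
  by rewrite ltnNge jj.
Unshelve. all: by end_near.
Qed.
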